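(* Let $d\ge2$ be a nonsquare integer with fundamental solution $(X_1,Y_1)$ of $x^2-dy^2=1$. Let $K$ be an integer with $K>X_1$ and $K\ge64$, and let $w=(2K)^3$. Then Program SO (defined in the context), on input $d,K,w$, returns $(X_1,Y_1)$. Its packed integer $M$ has at most $3wK^3=O(K^6)$ binary digits. The intermediates outside the Hamming-weight subroutine have $O(K^6+dK^5)$ binary digits, and hence $O(K^6)$ when $K\ge d$.
   Context: The fundamental solution is the solution of $x^2-dy^2=1$ in positive integers with $X_1$ least. All values are in $\mathbb N=\{0,1,2,\dots\}$; $u\mathbin{\dot{-}}v=\max(u-v,0)$; $u\bmod v$ is the remainder; divisors are positive. The constants implied by $O(\cdot)$ are absolute. Intermediates are all values computed while evaluating the assignments; those ''outside the Hamming-weight subroutine'' are all except the ones computed inside the call $\mathsf H(M)$ below. Subroutine $\mathsf G_{02}(Q,K,t)$ returns $(G_0,G_2)$ computed by: $u=Q\mathbin{\dot{-}}1$, $Z_Q=Q^K$, $v=ut$, $Q_+=Q+1$, $u_3=u^3$, $G_0=\lfloor Z_Q/u\rfloor$, $z=v\mathbin{\dot{-}}2$, $g_2=vz+Q_+$, $G_2=\lfloor Z_Qg_2/u_3\rfloor$. A fourth argument, when present, supplies the already computed value $Z_Q=Q^K$. Subroutine $\mathsf H(m)$ (Hamming weight, default form): $a=2m$, $L=2^a$, $\alpha=\lfloor(L+1)^a/L^m\rfloor\bmod L$, $e=a$, $\Pi=L$, $\gamma=\alpha\Pi$, $g=\Bigl(\Bigl\lfloor\frac{2^{\gamma(\gamma+\alpha+\Pi)}}{(2^{\gamma\alpha}\mathbin{\dot{-}}1)(2^{\gamma\Pi}\mathbin{\dot{-}}1)}\Bigr\rfloor\bmod2^\gamma\Bigr)\mathbin{\dot{-}}1$,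 $u=\Pi\mathbin{\dot{-}}1$, output $\lfloor(g^e\bmod u^2)/u\rfloor$. Subroutine $\mathsf C(d,K,A,p,v)$: $h=2K$, $z_c=p+1$, $c_K=\lfloor z_c^h/v\rfloor\bmod p$, $H_c=dh$, $c_{dK}=\lfloor z_c^{H_c}/v^d\rfloor\bmod p$, $a_c=2^{H_c\mathbin{\dot{-}}h}c_K$; it returns $\lfloor Ac_{dK}/a_c\rfloor$. Subroutine $\mathsf R(d,A,B)$: $V_B=d(BB)$, $c=(AA\mathbin{\dot{-}}A)\mathbin{\dot{-}}V_B$, $V_c=cc$, $D_c=V_c\mathbin{\dot{-}}V_B$; it returns the pair $\bigl(\lfloor(V_c+V_B)/D_c\rfloor,\ \lfloor(2B)c/D_c\rfloor\bigr)$. Program SO, with input $d,K,w$ (local variables of subroutines are separate): SO1. $t=K\mathbin{\dot{-}}1$, $P=2^w$, $P_-=P\mathbin{\dot{-}}1$, $q=P^3$, $q_1=q^K$, $q_2=q_1^K$, $Q=q_1q_2$. SO2. $(U_0,U_2)=\mathsf G_{02}(Q,K,t)$, $(V_0,V_2)=\mathsf G_{02}(q,K,t,q_1)$. SO3. $T_s=P_-\bigl[V_0((P+2)U_0\mathbin{\dot{-}}U_2)+U_0(dV_2)\bigr]$. SO4. $M=\lfloor T_s/(q_2\mathbin{\dot{-}}1)\rfloor$ (the packed integer). SO5. $H_M=\mathsf H(M)$. SO6. $\sigma=\lfloor(KK)t/2\rfloor$, $A=\lfloor H_M/w\rfloor\mathbin{\dot{-}}\sigma$. SO7. $B=\mathsf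 C(d,K,A,q_1,q_2)$. SO8. Return $\mathsf R(d,A,B)$. *)

(* Defs.v *)
From mathcomp Require Import all_boot ssralg ssrint.

Set Implicit Arguments.
Unset Strict Implicit.
Unset Printing Implicit Defensive.

(* Arithmetic terms over nat, kept as syntax so that the value of every        *)
(* operation can be recorded.  [Osub] is truncated subtraction and [Odiv] is   *)
(* the floor quotient.                                                         *)
Inductive binop := Oadd | Osub | Omul | Odiv | Omod | Oexp.

Inductive aexpr :=
| Val of nat
| Op of binop & aexpr & aexpr.

Coercion Val : nat >-> aexpr.

Declare Scope aexpr_scope.
Delimit Scope aexpr_scope with aexpr.
Bind Scope aexpr_scope with aexpr.
Notation "x + y" := (Op Oadd x y) : aexpr_scope.
Notation "x - y" := (Op Osub x y) : aexpr_scope.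
Notation "x * y" := (Op Omul x y) : aexpr_scope.
Notation "x %/ y" := (Op Odiv x y) : aexpr_scope.
Notation "x %% y" := (Op Omod x y) : aexpr_scope.
Notation "x ^ y" := (Op Oexp x y) : aexpr_scope.

Definition op_eval (o : binop) : nat -> nat -> nat :=
  match o with
  | Oadd => addn
  | Osub => subn
  | Omul => muln
  | Odiv => divn
  | Omod => modn
  | Oexp => expn
  end.

Fixpoint eval (e : aexpr) : nat :=
  match e with
  | Val n => n
  | Op o e1 e2 => op_eval o (eval e1) (eval e2)
  end.

(* Leaves (numerals and already computed variables) contribute nothing. *)
Fixpoint trace (e : aexpr) : seq nat :=
  match e with
  | Val _ => [::]
  | Op _ e1 e2 => trace e1 ++ trace e2 ++ [:: eval e]
  end.

(* A computation is its result paired with the values computed on the way. *)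
Definition comp (T : Type) : Type := (T * seq nat)%type.

Definition result (T : Type) (c : comp T) : T := c.1.
Definition intermediates (T : Type) (c : comp T) : seq nat := c.2.

Definition ret (T : Type) (x : T) : comp T := (x, [::]).

Definition bind (S T : Type) (c : comp S) (f : S -> comp T) : comp T :=
  (result (f (result c)), intermediates c ++ intermediates (f (result c))).

Definition run (e : aexpr) : comp nat := (eval e, trace e).

(* A value obtained from outside the recorded computation: only the value      *)
(* itself is recorded, not the way it was computed.                            *)
Definition oracle (n : nat) : comp nat := (n, [:: n]).

Notation "'set!' x := e 'in' k" := (bind (run e%aexpr) (fun x => k))
  (at level 200, x name, e at level 200, k at level 200,
   format "'[v' 'set!'  x  :=  e  'in' '/' k ']'").
Notation "'call!' x := c 'in' k" := (bind c (fun x => k))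
  (at level 200, x pattern, c at level 200, k at level 200,
   format "'[v' 'call!'  x  :=  c  'in' '/' k ']'").

(* [ZQ0] is the optional already computed value of Q ^ K. *)
Definition subG02 (Q K t : nat) (ZQ0 : option nat) : comp (nat * nat) :=
  set! u := Q - 1 in
  call! ZQ := (if ZQ0 is Some Z then ret Z else run (Q ^ K)%aexpr) in
  set! v := u * t in
  set! Qp := Q + 1 in
  set! u3 := u ^ 3 in
  set! G0 := ZQ %/ u in
  set! z := v - 2 in
  set! g2 := v * z + Qp in
  set! G2 := (ZQ * g2) %/ u3 in
  ret (G0, G2).

Definition subH (m : nat) : nat :=
  let a := 2 * m in
  let L := 2 ^ a in
  let alpha := ((L + 1) ^ a %/ L ^ m) %% L in
  let e := a in
  let Pi := L in
  let gamma := alpha * Pi in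
  let g := (2 ^ (gamma * (gamma + alpha + Pi))
              %/ ((2 ^ (gamma * alpha) - 1) * (2 ^ (gamma * Pi) - 1)))
             %% 2 ^ gamma - 1 in
  let u := Pi - 1 in
  (g ^ e %% u ^ 2) %/ u.

Definition subC (d K A p v : nat) : comp nat :=
  set! h := 2 * K in
  set! zc := p + 1 in
  set! cK := (zc ^ h %/ v) %% p in
  set! Hc := d * h in
  set! cdK := (zc ^ Hc %/ v ^ d) %% p in
  set! ac := 2 ^ (Hc - h) * cK in
  set! B := (A * cdK) %/ ac in
  ret B.

Definition subR (d A B : nat) : comp (nat * nat) :=
  set! VB := d * (B * B) in
  set! c := (A * A - A) - VB in
  set! Vc := c * c in
  set! Dc := Vc - VB in
  set! X := (Vc + VB) %/ Dc in
  set! Y := ((2 * B) * c) %/ Dc in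
  ret (X, Y).

Record output := Output { packed : nat; answer : nat * nat }.

Definition programSO (d K w : nat) : comp output :=
  set! t := K - 1 in
  set! P := 2 ^ w in
  set! Pm := P - 1 in
  set! q := P ^ 3 in
  set! q1 := q ^ K in
  set! q2 := q1 ^ K in
  set! Q := q1 * q2 in
  call! (U0, U2) := subG02 Q K t None in
  call! (V0, V2) := subG02 q K t (Some q1) in
  set! Ts := Pm * (V0 * ((P + 2) * U0 - U2) + U0 * (d * V2)) in
  set! M := Ts %/ (q2 - 1) in
  call! HM := oracle (subH M) in
  set! sigma := ((K * K) * t) %/ 2 in
  set! A := HM %/ w - sigma in
  call! B := subC d K A q1 q2 in
  call! XY := subR d A B in
  ret (Output M XY).

(* The number of binary digits; 0 has one digit. *)
Definition bits (n : nat) : nat := (trunc_log 2 n).+1.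

Definition pell_solution (d x y : nat) : Prop :=
  [/\ 0 < x, 0 < y & (x%:Z ^+ 2 - d%:Z * y%:Z ^+ 2 = 1)%R].

Definition fundamental_solution (d X Y : nat) : Prop :=
  pell_solution d X Y /\ forall x y : nat, pell_solution d x y -> X <= x.

(* Main.v *)
Require Import Defs.
From mathcomp Require Import all_boot ssralg ssrint.
From mathcomp Require Import zify ring.

(** The program evaluates one packed integer [M] whose Hamming weight encodes the
    sum of the solutions of [x ^ 2 - d y ^ 2 = 1] below [K], and then extracts the
    fundamental solution from this sum.

    The product of [2 ^ w - 1] with a positive integer at most [2 ^ w] has exactly
    [w] ones. So the number [(2 ^ w - 1) (2 ^ w + 2 - n)], [n = i ^ 2 - d j ^ 2], has
    weight [w] for [n >= 2] and [2 w] for [n = 1]; for [n <= 0] its weight is [w] plus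
    the 2-adic valuation of [1 - n] ([weight_entry]). The closed forms of the sums
    of [Q ^ i] and [i ^ 2 Q ^ i] place these numbers in disjoint digits, and the
    division by [q2 - 1] repeats row [i] exactly [i] times ([stacked_quotient]).
    Hence the weight of [M] is [w (sigma + A) + E], where [A] is the sum of the first
    coordinates [i < K] of the solutions, the trivial solution [(1, 0)] included,
    and [E] is a weighted sum of valuations. For fixed [j], a square root modulo
    [2 ^ (2h + 1)] is determined up to sign modulo [2 ^ (h + 1)], so high
    valuations are rare and [E < 8 K ^ 3 = w] ([total_excess_lt]); the division by
    [w] yields [A].

    The weight itself is computed as the exponent of 2 in the central binomial
    coefficient, which is a digit of a power of [L + 1]. Its gcd with a large power
    of 2 is obtained from Mazzanti's formula, which counts the lattice points on
    a segment by a division ([gcd_power_quotient], [subH_weight]).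

    Let [e = X + Y sqrt d] be the fundamental solution. Descent shows that the
    solutions are the powers of [e] ([pell_complete]), so [A + B sqrt d] is a
    geometric sum [1 + e + ... + e ^ r], with [B] the sum of the second coordinates.
    Here [B] is the floor of [A / sqrt d], and [1 / sqrt d] is approximated from
    above by a quotient of two central binomial coefficients; the gap between
    [A / sqrt d] and [B + 1] is large enough for this approximation
    ([central_bin_quotient], [rounding_margin]). Finally
    [c = A ^ 2 - A - d B ^ 2] satisfies [c + B sqrt d = e (c - B sqrt d)], so [X] and [Y]
    are the coordinates of [(c + B sqrt d) ^ 2 / (c ^ 2 - d B ^ 2)]
    ([pell_recovery]).

    The sizes follow by adding exponents along the program: the largest value
    outside the binomial part is [Q ^ K] times small factors, with about
    [3 w K ^ 3] bits, and the binomial part works with numbers of [O (d w K ^ 2)]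
    bits. *)

Set Implicit Arguments.
Unset Strict Implicit.
Unset Printing Implicit Defensive.

(** * Hamming weight as a 2-adic valuation *)

(** Kummer: the exponent of 2 in the central binomial coefficient is the number
    of carries in the addition [n + n], that is the number of ones of [n]. *)
Definition weight n := logn 2 'C(2 * n, n).

Lemma logn2_fact_double n : logn 2 (2 * n)`! = n + logn 2 n`!.
Proof.
elim: n => [|n IH]; first by rewrite muln0 !fact0 logn1.
have -> : 2 * n.+1 = (2 * n).+2 by lia.
rewrite !factS; have -> : (2 * n).+2 = 2 * n.+1 by lia.
have odd_part : logn 2 (2 * n).+1 = 0.
  by apply: logn_coprime; rewrite coprime2n /= mul2n odd_double.
rewrite !lognM ?muln_gt0 ?fact_gt0 // odd_part IH.
by rewrite -[logn 2 2]/1; lia.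
Qed.

(** Legendre's formula: it transfers the recursion of the factorial on binary
    digits to [weight]. *)
Lemma weight_legendre n : weight n + logn 2 n`! = n.
Proof.
have le_n : n <= 2 * n by lia.
have := congr1 (logn 2) (bin_fact le_n).
have -> : 2 * n - n = n by lia.
rewrite !lognM ?muln_gt0 ?fact_gt0 ?bin_gt0 // logn2_fact_double.
rewrite /weight; lia.
Qed.

Lemma weight0 : weight 0 = 0.
Proof. by have := weight_legendre 0; lia. Qed.

(** Adding 1 to [n] turns its block of trailing ones into zeros. *)
Lemma weightS n : weight n.+1 + logn 2 n.+1 = (weight n).+1.
Proof.
have := weight_legendre n.+1; have := weight_legendre n.
by rewrite factS lognM ?fact_gt0 //; lia.
Qed.

Lemma weight_double n : weight n.*2 = weight n.
Proof.
have := weight_legendre n.*2; have := weight_legendre n.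
by rewrite -mul2n logn2_fact_double; lia.
Qed.

Lemma weight_bit (b : bool) n : weight (b + n.*2) = b + weight n.
Proof.
case: b; last by rewrite add0n weight_double.
have := weightS n.*2; rewrite weight_double lognE /= dvdn2 /= odd_double /=.
by rewrite add1n; lia.
Qed.

Lemma weight1 : weight 1 = 1.
Proof. by have := weight_bit true 0; rewrite weight0. Qed.

Lemma leq_weight n : weight n <= n.
Proof. by have := weight_legendre n; lia. Qed.

Lemma weight_cat k x y : x < 2 ^ k -> weight (x + 2 ^ k * y) = weight x + weight y.
Proof.
elim: k x => [|k IH] x xk.
  have -> : x = 0 by lia.
  by rewrite weight0 mul1n.
have xE := odd_double_half x.
have hk : x./2 < 2 ^ k by move: xk; rewrite expnS; lia.
have -> : x + 2 ^ k.+1 * y = odd x + (x./2 + 2 ^ k * y).*2.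
  by rewrite -{1}xE expnS; lia.
by rewrite -{3}xE !weight_bit IH // addnA.
Qed.

Lemma weight_compl k x : x < 2 ^ k -> weight x + weight (2 ^ k - 1 - x) = k.
Proof.
elim: k x => [|k IH] x xk.
  have -> : x = 0 by lia.
  by rewrite weight0.
have xE := odd_double_half x.
have hk : x./2 < 2 ^ k by move: xk; rewrite expnS; lia.
have -> : 2 ^ k.+1 - 1 - x = ~~ (odd x) + (2 ^ k - 1 - x./2).*2.
  by move: hk xk xE; rewrite expnS; case: (odd x) => /=; lia.
rewrite -{1}xE !weight_bit.
by have := IH _ hk; case: (odd x) => /=; lia.
Qed.

(** * Digit expansions *)

Lemma sum_digits_lt B n (a : nat -> nat) :
  (forall i, i < n -> a i < B) -> \sum_(i < n) B ^ i * a i < B ^ n.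
Proof.
elim: n => [|n IH] ha; first by rewrite big_ord0.
rewrite big_ord_recr /= expnSr.
have := IH (fun i hi => ha i (ltnW hi)); rewrite -(ltn_add2r (B ^ n * a n)).
by move=> /leq_trans; apply; rewrite -mulnS leq_mul2l ha ?orbT.
Qed.

Lemma sum_digits_pred_lt B n (a : nat -> nat) :
  0 < n -> (forall i, i < n -> (a i).+1 < B) ->
  (\sum_(i < n) B ^ i * a i).+1 < B ^ n.
Proof.
case: n => // n _ ha; rewrite (leq_ltn_trans _ (sum_digits_lt ha)) //.
have -> : \sum_(i < n.+1) B ^ i * (a i).+1 =
          \sum_(i < n.+1) B ^ i * a i + \sum_(i < n.+1) B ^ i.
  by rewrite -big_split; apply: eq_bigr => i _; rewrite mulnS addnC.
by rewrite -addn1 leq_add2l big_ord_recl expn0 leq_addr.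
Qed.

Lemma sum_digits_divn_modn B n k (a : nat -> nat) :
  k < n -> (forall i, i < n -> a i < B) ->
  (\sum_(i < n) B ^ i * a i) %/ B ^ k %% B = a k.
Proof.
move=> kn ha; have B0 : 0 < B by case: B ha => // /(_ k kn).
elim: n k a kn ha => // n IH k a kn ha.
have -> : \sum_(i < n.+1) B ^ i * a i = (\sum_(i < n) B ^ i * a i.+1) * B + a 0.
  rewrite big_ord_recl expn0 mul1n addnC big_distrl /=; congr (_ + _).
  by apply: eq_bigr => i _; rewrite /bump /= add1n expnS; lia.
have a0 := ha 0 isT.
case: k kn => [|k] kn; first by rewrite divn1 modnMDl modn_small.
rewrite expnS divnMA divnMDl // (divn_small a0) addn0.
by rewrite (IH k (fun i => a i.+1)) // => i hi; apply: ha.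
Qed.

Lemma weight_sum_digits k n (a : nat -> nat) :
  (forall i, i < n -> a i < 2 ^ k) ->
  weight (\sum_(i < n) (2 ^ k) ^ i * a i) = \sum_(i < n) weight (a i).
Proof.
elim: n => [|n IH] ha; first by rewrite !big_ord0 weight0.
have ha' i : i < n -> a i < 2 ^ k by move=> hi; apply/ha/ltnW.
have := sum_digits_lt ha'.
by rewrite !big_ord_recr /= -IH // -expnM => /weight_cat ->.
Qed.

(** * The Hamming-weight subroutine *)

Lemma binomial_digit B n k :
  k <= n -> (forall i, 'C(n, i) < B) -> (B + 1) ^ n %/ B ^ k %% B = 'C(n, k).
Proof.
move=> kn hB.
have -> : (B + 1) ^ n = \sum_(i < n.+1) B ^ i * 'C(n, i).
  rewrite addnC expnDn; apply: eq_bigr => i _.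
  by rewrite exp1n mul1n mulnC.
by rewrite (@sum_digits_divn_modn B n.+1 k (fun i => 'C(n, i))).
Qed.

Lemma leq_bin_exp2 n i : 'C(n, i) <= 2 ^ n.
Proof.
elim: n i => [|n IH] [|i]; rewrite ?bin0 ?expn_gt0 ?bin0n //.
by rewrite binS expnS mul2n -addnn leq_add.
Qed.

Lemma ltn_bin_exp2 n i : 0 < n -> 'C(n, i) < 2 ^ n.
Proof.
case: n => // n _; case: i => [|i]; first by rewrite bin0 -{1}(expn0 2) ltn_exp2l.
elim: n i => [|n IH] i; first by rewrite binS bin0n bin0n; case: i.
rewrite binS expnS mul2n -addnn -addSn leq_add // leq_bin_exp2 //.
Qed.

(** [b] divides [a i] exactly when [b / gcd a b] divides [i], and both ends of the
    range [0 .. b] are counted. *)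
Lemma count_mult_gcd a b : 0 < b ->
  \sum_(i < b.+1) (b %| a * i) = (gcdn a b).+1.
Proof.
move=> b0; have g0 : 0 < gcdn a b by rewrite gcdn_gt0 b0 orbT.
have bE : b = (b %/ gcdn a b) * gcdn a b by rewrite divnK ?dvdn_gcdr.
have aE : a = (a %/ gcdn a b) * gcdn a b by rewrite divnK ?dvdn_gcdl.
have m0 : 0 < b %/ gcdn a b by rewrite divn_gt0 // dvdn_leq ?dvdn_gcdr.
have cop : coprime (b %/ gcdn a b) (a %/ gcdn a b).
  rewrite /coprime -(eqn_pmul2r g0) muln_gcdl -aE -bE mul1n gcdnC.
  by rewrite eqxx.
rewrite big_ord_recl muln0 dvdn0 /= add1n; congr _.+1.
transitivity (\sum_(1 <= i < b.+1) (b %/ gcdn a b %| i)).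
  rewrite big_add1 /= big_mkord; apply: eq_bigr => i _; rewrite /bump /= add1n.
  congr nat_of_bool.
  by rewrite [X in X %| _]bE [X in _ %| X * _]aE mulnAC dvdn_pmul2r // Gauss_dvdr.
by rewrite -divn_count_dvd {1}bE mulKn.
Qed.

(** Mazzanti's formula. The quotient expands
    [W^(ab+a+b) / ((W^a - 1)(W^b - 1))] as a power series in [1/W], and the
    coefficient of [W^0] counts the pairs [i, j >= 0] with [a i + b j = a b],
    of which there are [gcd a b + 1]; [W] is large enough to prevent carries
    and to make the negative powers of [W] sum to less than 1. *)
Lemma gcd_power_quotient a b : 1 < a -> 1 < b ->
  let W := 2 ^ (a * b) in
  W ^ (a * b + a + b) %/ ((W ^ a - 1) * (W ^ b - 1)) %% W = (gcdn a b).+1.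
Proof.
move=> a1 b1 W; pose p := W ^ a; pose r := W ^ b.
have W_ge : 2 * (b + 2) <= W.
  rewrite (@leq_trans (2 ^ (2 * b))) ?leq_exp2l ?leq_mul2r ?a1 ?orbT //.
  rewrite expnM -[2 ^ 2]/4; clear -b1; elim: b b1 => // [[|[|b]]] IH _ //.
  by have := IH isT; rewrite !expnS; lia.
have p_ge : W <= p by rewrite /p -{1}(expn1 W) leq_pexp2l //; lia.
have rE : r = W * W ^ b.-1 by rewrite -expnS prednK //; lia.
have W1_gt0 : 1 < W ^ b.-1.
  by rewrite -(exp1n b.-1) ltn_exp2r; lia.
pose quo i := a * i %/ b; pose rem i := a * i %% b.
pose F := \sum_(i < b.+1) W ^ rem i.
pose S := \sum_(i < b.+1) W ^ rem i * \sum_(l < (quo i).+1) r ^ l.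
(* [S] is the quotient and [(p - 1) * F + r] the remainder; two geometric series
   give the two identities behind this division *)
have geomS : (r - 1) * S + F = r * \sum_(i < b.+1) p ^ i.
  rewrite /S /F !big_distrr -big_split; apply: eq_bigr => i _ /=.
  rewrite mulnCA subn1 -predn_exp -subn1 -[X in _ + X]muln1 -mulnDr subnK.
    rewrite /p /r -!expnM -!expnD; congr (_ ^ _).
    by have := divn_eq (a * i) b; rewrite -/(quo i) -/(rem i); lia.
  by rewrite expn_gt0 rE muln_gt0 (ltnW W1_gt0) andbT; lia.
have geomP : (p - 1) * (\sum_(i < b.+1) p ^ i) + 1 = p ^ b.+1.
  by rewrite subn1 -predn_exp addn1 prednK // expn_gt0; lia.
have numE : W ^ (a * b + a + b) = S * ((p - 1) * (r - 1)) + ((p - 1) * F + r).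
  have -> : W ^ (a * b + a + b) = r * p ^ b.+1.
    by rewrite /p /r -expnM -expnD; congr (_ ^ _); lia.
  by rewrite -geomP mulnDr muln1 mulnCA -geomS; ring.
have F_le : F <= (b.+1) * W ^ b.-1.
  rewrite -[X in X * _]card_ord -sum_nat_const; apply: leq_sum => i _.
  have : rem i < b by rewrite ltn_mod; lia.
  by move=> rem_b; rewrite leq_pexp2l //; lia.
have rem_lt : (p - 1) * F + r < (p - 1) * (r - 1).
  have : 2 * (b + 2) * W ^ b.-1 <= r by rewrite rE leq_mul2r W_ge orbT.
  have hr : 2 * F + r < 2 * (r - 1) by nia.
  have h2 : 2 * r <= (p - 1) * r by rewrite leq_mul2r; lia.
  nia.
rewrite numE divnMDl; last by lia.
rewrite (divn_small rem_lt) addn0 /S.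
rewrite -modn_summ.
rewrite (eq_bigr (fun i : 'I_b.+1 => nat_of_bool (b %| a * i))).
  rewrite count_mult_gcd; last by lia.
  by rewrite modn_small //; have := dvdn_leq (ltnW b1) (dvdn_gcdr a b); lia.
move=> i _.
have [hd|hd] := boolP (b %| a * i).
  have -> : rem i = 0 by apply/eqP.
  rewrite expn0 mul1n big_ord_recl expn0 addnC.
  set tail := \sum_(_ < _) _.
  have /dvdnP[c ->] : W %| tail.
    by apply: dvdn_sum => j _; rewrite /= /bump leq0n add1n expnS rE -mulnA dvdn_mulr.
  by rewrite modnMDl modn_small //; lia.
apply/eqP/dvdn_mulr.
have : 0 < rem i by rewrite lt0n.
by case: (rem i) => // k _; rewrite expnS dvdn_mulr.
Qed.

(** [subH] chains three facts: a central binomial coefficient is a digit of a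
    power of [L + 1]; its gcd with the large power [L] of 2 is [2 ^ weight m];
    and [L ^ s] is [1 + s (L - 1)] modulo [(L - 1) ^ 2], so that raising that
    gcd to the power [2 * m] lets the exponent [s] be read off. *)
Lemma subH_weight m : 0 < m -> subH m = weight m.
Proof.
move=> m0; rewrite /subH.
set a := 2 * m; set L := 2 ^ a.
have a0 : 0 < a by lia.
have L4 : 4 <= L by rewrite -[4]/(2 ^ 2) leq_exp2l; lia.
rewrite binomial_digit; [|lia|by move=> i; apply: ltn_bin_exp2].
set al := 'C(a, m).
have al1 : 1 < al.
  rewrite /al /a; case: m m0 {a L L4 a0 al} => // m _.
  have -> : 2 * m.+1 = (2 * m).+2 by lia.
  rewrite binS -[2]/(1 + 1) leq_add // bin_gt0; lia.
rewrite [2 ^ (al * L * _)]expnM [2 ^ (al * L * al)]expnM [2 ^ (al * L * L)]expnM.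
rewrite gcd_power_quotient //; last by lia.
rewrite subn1 /=.
have -> : gcdn al L = 2 ^ weight m.
  have le_wa : weight m <= a by rewrite (leq_trans (leq_weight m)) // /a; lia.
  have al_gt0 : 0 < al by lia.
  apply/eqP; rewrite eqn_dvd dvdn_gcd pfactor_dvdnn dvdn_exp2l // !andbT.
  have /(dvdn_pfactor _ _ (isT : prime 2))[k _ gE] := dvdn_gcdr al L.
  by rewrite gE dvdn_exp2l // -pfactor_dvdn // -gE dvdn_gcdl.
set s := weight m; set u := L - 1.
have LE : L = u + 1 by rewrite /u subnK //; lia.
rewrite -expnM mulnC expnM -/L.
have [k ->] : exists k, L ^ s = k * u ^ 2 + (1 + s * u).
  rewrite LE; elim: (s) => [|j [k hk]]; first by exists 0; rewrite expn0; lia.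
  by exists (k * (u + 1) + j); rewrite expnS hk; ring.
have su : s < u.
  rewrite (leq_ltn_trans (leq_weight m)) // /u /L /a.
  have := ltn_expl m (isT : 1 < 2); rewrite mul2n -addnn expnD; nia.
have -> : (k * u ^ 2 + (1 + s * u)) %% u ^ 2 = s * u + 1.
  by rewrite modnMDl modn_small 1?addnC // -mulnn; nia.
by rewrite divnMDl ?divn_small ?addn0 //; lia.
Qed.

(** * Packing sums over a square *)

Lemma geometric_quotient Q K : 2 < Q -> Q ^ K %/ (Q - 1) = \sum_(i < K) Q ^ i.
Proof.
move=> Q2; have -> : Q ^ K = (\sum_(i < K) Q ^ i) * (Q - 1) + 1.
  by rewrite mulnC subn1 -predn_exp addn1 prednK // expn_gt0; lia.
by rewrite divnMDl ?divn_small ?addn0; lia.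
Qed.

(** Applying [Q d/dQ] twice to a geometric series gives a fraction with
    denominator [(Q - 1) ^ 3]; the low terms [Q ^ 2 + Q] of its numerator are
    smaller than that denominator, so the floor absorbs them. *)
Lemma geometric_square_quotient Q K : 4 < Q -> 1 < K ->
  let u := Q - 1 in let v := u * (K - 1) in
  (Q ^ K * (v * (v - 2) + (Q + 1))) %/ u ^ 3 = \sum_(i < K) i ^ 2 * Q ^ i.
Proof.
move=> Q4 K1 u v.
have [m uE] : exists m, u = m + 4 by exists (Q - 5); rewrite /u; lia.
have QE : Q = m + 5 by rewrite /u in uE; lia.
have [k KE] : exists k, K = k.+2 by exists (K - 2); lia.
have vE : v = (m + 4) * k.+1 by rewrite /v uE KE subSS subn0.
clearbody v; clearbody u; subst Q K u.
have closed_form n : (m + 5) ^ n.+1 * (((m + 4) * n) ^ 2 + (m + 6)) =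
    (m + 4) ^ 3 * (\sum_(i < n.+1) i ^ 2 * (m + 5) ^ i)
    + ((m + 5) ^ 2 + (m + 5)) + 2 * ((m + 4) * n) * (m + 5) ^ n.+1.
  elim: n => [|n IH]; first by rewrite big_ord_recl big_ord0 /= expn1; lia.
  rewrite big_ord_recr /= mulnDr; move: IH; set S := \sum_(_ < _) _.
  by rewrite (expnS _ n.+1); set Z := (m + 5) ^ n.+1; lia.
have -> : (m + 5) ^ k.+2 * (v * (v - 2) + (m + 5 + 1)) =
   (\sum_(i < k.+2) i ^ 2 * (m + 5) ^ i) * (m + 4) ^ 3
   + ((m + 5) ^ 2 + (m + 5)).
  apply/(@addIn (2 * ((m + 4) * k.+1) * (m + 5) ^ k.+2)).
  rewrite [X in _ = X + _](_ : _ = (m + 4) ^ 3 *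
    (\sum_(i < k.+2) i ^ 2 * (m + 5) ^ i) + ((m + 5) ^ 2 + (m + 5)));
    last by rewrite mulnC.
  rewrite -closed_form -vE.
  have [z ->] : exists z, v = z + 2 by exists (v - 2); rewrite vE; nia.
  by rewrite addnK; ring.
by rewrite divnMDl ?divn_small ?addn0 //; lia.
Qed.

Definition stacked B K (row : nat -> nat) :=
  \sum_(l < K) (B ^ K) ^ l * \sum_(i < K) B ^ i * (if l < i then row i else 0).

(** With [D = B ^ K], one has
    [D ^ i / (D - 1) = D ^ (i - 1) + ... + D + 1 + 1 / (D - 1)], so dividing by [D - 1]
    copies row [i] into the [i] disjoint blocks [l < i]. This is how a solution
    [(i, j)] comes to be counted [i] times. The rows stay below [B - 1], which
    keeps the sum of the fractional parts below 1. *)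
Lemma stacked_quotient B K row : 0 < K -> (forall i, i < K -> (row i).+1 < B) ->
  (\sum_(i < K) (B * B ^ K) ^ i * row i) %/ (B ^ K - 1) = stacked B K row.
Proof.
move=> K0 hrow; have lt_rem := sum_digits_pred_lt K0 hrow.
have stackedE : stacked B K row =
    \sum_(i < K) B ^ i * row i * \sum_(l < i) (B ^ K) ^ l.
  rewrite /stacked (eq_bigr _ (fun _ _ => big_distrr _ _ _)) exchange_big /=.
  apply: eq_bigr => i _; rewrite (big_ord_widen K (fun l => (B ^ K) ^ l)) 1?ltnW //.
  rewrite big_distrr /= [RHS]big_mkcond; apply: eq_bigr => l _.
  by case: ltnP => _; rewrite ?muln0 // mulnC.
have -> : \sum_(i < K) (B * B ^ K) ^ i * row i =
    stacked B K row * (B ^ K - 1) + \sum_(i < K) B ^ i * row i.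
  rewrite stackedE big_distrl -big_split; apply: eq_bigr => i _ /=.
  rewrite -[_ * _ * (_ - 1)]mulnA [_ * (B ^ K - 1)]mulnC subn1 -predn_exp -subn1.
  rewrite -[X in _ = _ + X]muln1 -mulnDr subnK ?expnMn; first by ring.
  rewrite !expn_gt0; have := hrow 0 K0; lia.
by rewrite divnMDl ?divn_small ?addn0 //; lia.
Qed.

Lemma stacked_lt B K row : (forall i, i < K -> row i < B) ->
  stacked B K row < (B ^ K) ^ K.
Proof.
move=> hrow; apply: (sum_digits_lt (a := fun l => \sum_(i < K) B ^ i *
  (if l < i then row i else 0))) => l _.
apply: (sum_digits_lt (a := fun i => if l < i then row i else 0)) => i hi.
by have := hrow i hi; case: ifP => //; lia.
Qed.

Lemma weight_stacked k K row : (forall i, i < K -> row i < 2 ^ k) ->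
  weight (stacked (2 ^ k) K row) = \sum_(i < K) i * weight (row i).
Proof.
move=> hrow.
have small l i : i < K -> (if l < i then row i else 0) < 2 ^ k.
  by move=> /hrow; case: ifP => // _; rewrite expn_gt0.
rewrite /stacked -expnM (@weight_sum_digits (k * K) K (fun l =>
  \sum_(i < K) (2 ^ k) ^ i * (if l < i then row i else 0))); last first.
  by move=> l _; rewrite expnM; apply: (sum_digits_lt (small l)).
transitivity (\sum_(l < K) \sum_(i < K) if l < i then weight (row i) else 0).
  apply: eq_bigr => l _; rewrite (weight_sum_digits (small l)).
  by apply: eq_bigr => i _; case: ifP => // _; rewrite weight0.
rewrite exchange_big; apply: eq_bigr => i _ /=.
rewrite -big_mkcond /= -(big_ord_widen K (fun=> weight (row i))) 1?ltnW //.
by rewrite sum_nat_const card_ord.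
Qed.

(** * The weight of one entry *)

(** The entry at [(i, j)] is [(2 ^ w - 1) (2 ^ w + 2 - n)] with
    [n = i ^ 2 - d j ^ 2]. A product of [2 ^ w - 1] with a positive integer at most
    [2 ^ w] has exactly [w] ones, so that the solutions [n = 1] stand out with
    [2 w] ones; the entries with [n <= 0] deviate only by a 2-adic valuation. *)
Definition entry d w i j := (2 ^ w - 1) * ((2 ^ w + 2 - i ^ 2) + d * j ^ 2).

Definition excess d i j :=
  if i ^ 2 <= d * j ^ 2 then logn 2 (1 + (d * j ^ 2 - i ^ 2)) else 0.

Lemma weight_entry d w i j : 0 < w -> i ^ 2 <= 2 ^ w -> d * j ^ 2 + 2 <= 2 ^ w ->
  weight (entry d w i j) = w + (i ^ 2 == d * j ^ 2 + 1) * w + excess d i j.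
Proof.
rewrite /entry /excess; set N := i ^ 2; set D := d * j ^ 2 => w0 hN hD.
have P2 : 1 < 2 ^ w by rewrite -{1}(expn0 2) ltn_exp2l.
have [le_ND|lt_DN] := leqP N D.
  have -> : N == D + 1 = false by apply/eqP; lia.
  set m := D - N.
  have -> : (2 ^ w - 1) * (2 ^ w + 2 - N + D)
    = (2 ^ w - 1 - m.+1) + 2 ^ w * (m + 2 ^ w * 1).
    have -> : 2 ^ w + 2 - N + D = 2 ^ w + 2 + m by lia.
    have [r rE] : exists r, 2 ^ w = r + m + 2 by exists (2 ^ w - 2 - m); lia.
    by rewrite rE; have -> : r + m + 2 - 1 = r + m.+1; [lia|]; rewrite addnK; lia.
  rewrite !weight_cat ?weight1; try by lia.
  have := weight_compl (_ : m.+1 < 2 ^ w); have := weightS m; rewrite add1n; lia.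
have [/eqP NE|neND] := boolP (N == D + 1).
  have -> : (2 ^ w - 1) * (2 ^ w + 2 - N + D)
    = (2 ^ w - 1) + 2 ^ w * (2 ^ w - 1).
    by have -> : 2 ^ w + 2 - N + D = 1 + 2 ^ w; [lia|]; ring.
  rewrite weight_cat; last by lia.
  have := weight_compl (_ : 0 < 2 ^ w); rewrite subn0 weight0; lia.
set y := 2 ^ w + 2 - N + D - 1.
have -> : (2 ^ w - 1) * (2 ^ w + 2 - N + D) = (2 ^ w - 1 - y) + 2 ^ w * y.
  have -> : 2 ^ w + 2 - N + D = y + 1 by lia.
  have [r rE] : exists r, 2 ^ w = r + y + 1 by exists (2 ^ w - 1 - y); lia.
  by rewrite rE; have -> : r + y + 1 - 1 = r + y; [lia|]; rewrite addnK; lia.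
rewrite weight_cat; last by lia.
have := weight_compl (_ : y < 2 ^ w); lia.
Qed.

Lemma entry_small d w i j : 1 < w -> d * j ^ 2 + 2 <= 2 ^ w ->
  (entry d w i j).+1 < (2 ^ w) ^ 3.
Proof.
move=> w1 hD; have : 2 ^ 2 <= 2 ^ w by rewrite leq_exp2l.
rewrite /entry; set P := 2 ^ w in hD * => P4.
have : (P - 1) * (P + 2 - i ^ 2 + d * j ^ 2) <= (P - 1) * (2 * P).
  by rewrite leq_mul2l; lia.
have [r rE] : exists r, P = r + 4 by exists (P - 4); lia.
by rewrite rE !expnS expn0; nia.
Qed.

(** * The total 2-adic excess *)

Lemma sum_ord_eq K v : \sum_(i < K) (i == v :> nat) = (v < K).
Proof.
elim: K => [|K IH]; first by rewrite big_ord0.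
by rewrite big_ord_recr /= IH; case: (ltngtP v K) => h; lia.
Qed.

Lemma count_residue K m c : 0 < m -> \sum_(i < K) (i %% m == c) <= (K %/ m).+1.
Proof.
move=> m0.
apply: (@leq_trans (\sum_(i < K) \sum_(t < (K %/ m).+1) (i == t * m + c :> nat))).
  apply: leq_sum => i _; case: eqP => //= <-.
  have it : i %/ m < (K %/ m).+1 by rewrite ltnS leq_div2r // ltnW.
  by rewrite (bigD1 (Ordinal it)) //= -divn_eq eqxx.
rewrite exchange_big /= -[X in _ <= X]card_ord -sum1_card; apply: leq_sum => t _.
by rewrite sum_ord_eq; case: ltnP.
Qed.

Lemma dvdn_exp2_half h x y :
  2 ^ (2 * h + 1) %| x * y -> (2 ^ h.+1 %| x) || (2 ^ h.+1 %| y).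
Proof.
case: (posnP x) => [->|x0]; first by rewrite dvdn0.
case: (posnP y) => [->|y0]; first by rewrite dvdn0 orbT.
by rewrite !pfactor_dvdn ?muln_gt0 ?x0 // lognM //; lia.
Qed.

(** If [2 ^ (2h + 1)] divides [i ^ 2 - k ^ 2], then [2 ^ (h + 1)] divides [i - k] or
    [i + k]; so all the counted [i] lie in two residue classes modulo
    [2 ^ (h + 1)]. *)
Lemma count_square_residue K D h :
  \sum_(i < K) ((i ^ 2 <= D) && (2 ^ (2 * h + 1) %| 1 + (D - i ^ 2)))
    <= 2 * (K %/ 2 ^ h.+1).+1.
Proof.
set m := 2 ^ h.+1; have m0 : 0 < m by rewrite expn_gt0.
pose T i := (i ^ 2 <= D) && (2 ^ (2 * h + 1) %| 1 + (D - i ^ 2)).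
have [/existsP[k Tk]|/existsPn noT] := boolP [exists k : 'I_K, T k]; last first.
  by rewrite big1 // => i _; have := noT i; rewrite /T => /negPf ->.
have diff i i' : T i -> T i' -> i' <= i -> 2 ^ (2 * h + 1) %| (i - i') * (i + i').
  move=> /andP[le_i dv_i] /andP[le_i' dv_i'] le_ii'.
  have sq : (i - i') * (i + i') = i ^ 2 - i' ^ 2 by rewrite subn_sqr.
  have := dvdn_sub dv_i' dv_i; rewrite sq.
  by have -> : 1 + (D - i' ^ 2) - (1 + (D - i ^ 2)) = i ^ 2 - i' ^ 2 by lia.
have res i : T i -> (i %% m == k %% m) || (i %% m == (m - k %% m) %% m).
  move=> Ti.
  have /orP[dvB|dvD] : (m %| (i - k) + (k - i)) || (m %| i + k).
  - case: (leqP k i) => ki; apply: dvdn_exp2_half.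
      by have -> : i - k + (k - i) = i - k; [lia|]; apply: diff.
    have -> : i - k + (k - i) = k - i by lia.
    by rewrite [i + k]addnC; apply: diff => //; apply: ltnW.
  - case: (leqP k i) dvB => ki.
      have -> : i - k + (k - i) = i - k by lia.
      by rewrite -eqn_mod_dvd // => ->.
    have -> : i - k + (k - i) = k - i by lia.
    by rewrite -eqn_mod_dvd 1?ltnW // eq_sym => ->.
  - apply/orP; right; rewrite -(eqn_modDr k) (eqP dvD) -modnDmr subnK ?modnn //.
    by rewrite ltnW // ltn_mod.
apply: (@leq_trans (\sum_(i < K)
    ((i %% m == k %% m) + (i %% m == (m - k %% m) %% m)))).
  apply: leq_sum => i _; have := res i; rewrite /T.
  by case: (_ && _) => // /(_ isT) /orP[] ->; lia.
by rewrite big_split mul2n -addnn leq_add // count_residue.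
Qed.

(** The count for the exponent [2h + 1] also bounds the one for [2h + 2], so only
    odd exponents are kept, each with multiplicity 2. *)
Lemma logn2_le_odd_exponents H x : 0 < x -> x < 2 ^ (2 * H) ->
  logn 2 x <= \sum_(h < H) 2 * (2 ^ (2 * h + 1) %| x).
Proof.
move=> x0 xH; have : logn 2 x <= 2 * H.
  rewrite -(@leq_exp2l 2) //.
  exact: leq_trans (dvdn_leq x0 (pfactor_dvdnn 2 x)) (ltnW xH).
have -> : \sum_(h < H) 2 * (2 ^ (2 * h + 1) %| x) =
          \sum_(h < H) 2 * (2 * h + 1 <= logn 2 x).
  by apply: eq_bigr => h _; rewrite pfactor_dvdn.
suff : minn (logn 2 x) (2 * H) <= \sum_(h < H) 2 * (2 * h + 1 <= logn 2 x) by lia.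
elim: H {xH} => [|H IH]; first by rewrite big_ord0; lia.
rewrite big_ord_recr /=; apply: leq_trans (leq_add IH (leqnn _)).
by case: (leqP (2 * H + 1) (logn 2 x)) => hH; lia.
Qed.

Lemma sum_halvings_le K H : \sum_(h < H) K %/ 2 ^ h.+1 <= K.
Proof.
suff : \sum_(h < H) K %/ 2 ^ h.+1 + K %/ 2 ^ H <= K by apply/leq_trans/leq_addr.
elim: H => [|H IH]; first by rewrite big_ord0 divn1.
rewrite big_ord_recr /= expnSr divnMA -addnA; apply: leq_trans IH.
by rewrite leq_add2l addnn -muln2 leq_divM.
Qed.

Lemma sum_excess_row d j K : 1 + d * j ^ 2 < 2 ^ (2 * K) ->
  \sum_(i < K) excess d i j <= 8 * K.
Proof.
set D := d * j ^ 2 => hD.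
apply: (@leq_trans (\sum_(i < K) \sum_(h < K)
   2 * ((i ^ 2 <= D) && (2 ^ (2 * h + 1) %| 1 + (D - i ^ 2))))).
  apply: leq_sum => i _; rewrite /excess -/D; case: ifP => //= _.
  by apply: logn2_le_odd_exponents; lia.
rewrite exchange_big /=.
apply: (@leq_trans (\sum_(h < K) (4 * (K %/ 2 ^ h.+1) + 4))).
  apply: leq_sum => h _; rewrite -big_distrr [X in _ <= X]addnC -mulnS -[4]/(2 * 2) -mulnA.
  by rewrite leq_mul2l count_square_residue orbT.
rewrite big_split -big_distrr sum_nat_const card_ord /=.
have -> : 8 * K = 4 * K + K * 4 by lia.
by rewrite leq_add2r leq_mul2l sum_halvings_le.
Qed.

(** The mean excess is at most 8, whence the choice [w = (2 K) ^ 3]: the excess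
    must stay below one unit of [w]. *)
Lemma total_excess_lt d K : 0 < K -> 1 + d * K ^ 2 < 2 ^ (2 * K) ->
  \sum_(i < K) i * \sum_(j < K) excess d i j < (2 * K) ^ 3.
Proof.
move=> K0 hK.
apply: (@leq_ltn_trans (\sum_(j < K) \sum_(i < K) K.-1 * excess d i j)).
  rewrite exchange_big /=; apply: leq_sum => i _.
  by rewrite -big_distrr leq_mul2r -ltnS prednK // ltn_ord orbT.
apply: (@leq_ltn_trans (\sum_(j < K) K.-1 * (8 * K))).
  apply: leq_sum => j _; rewrite -big_distrr leq_mul2l sum_excess_row ?orbT //.
  apply: leq_ltn_trans hK; rewrite leq_add2l leq_mul2l leq_sqr ltnW ?orbT //.
rewrite sum_nat_const card_ord.
by case: K K0 {hK} => // K _; lia.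
Qed.

(** * Solutions of the Pell equation *)

(** The coordinates of [(X + Y sqrt d) ^ m]. *)
Fixpoint pell_power d X Y m : nat * nat :=
  if m is k.+1 then
    let: (x, y) := pell_power d X Y k in (X * x + d * Y * y, Y * x + X * y)
  else (1, 0).

Definition pellX d X Y m := (pell_power d X Y m).1.
Definition pellY d X Y m := (pell_power d X Y m).2.

Lemma pellXS d X Y m :
  pellX d X Y m.+1 = X * pellX d X Y m + d * Y * pellY d X Y m.
Proof. by rewrite /pellX /pellY /=; case: pell_power. Qed.

Lemma pellYS d X Y m : pellY d X Y m.+1 = Y * pellX d X Y m + X * pellY d X Y m.
Proof. by rewrite /pellX /pellY /=; case: pell_power. Qed.

Lemma pell_solution_nat d x y :
  pell_solution d x y <-> [/\ 0 < x, 0 < y & x ^ 2 = d * y ^ 2 + 1].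
Proof. by split=> -[x0 y0 eq_xy]; split=> //; lia. Qed.

Lemma pell_norm d X Y m : X ^ 2 = d * Y ^ 2 + 1 ->
  pellX d X Y m ^ 2 = d * pellY d X Y m ^ 2 + 1.
Proof.
move=> normE; elim: m => [|m IH]; first by rewrite /pellX /pellY /=; lia.
rewrite pellXS pellYS; move: (pellX d X Y m) (pellY d X Y m) IH => x y IH.
have -> : (X * x + d * Y * y) ^ 2 =
    X ^ 2 * x ^ 2 + d ^ 2 * Y ^ 2 * y ^ 2 + 2 * d * X * Y * x * y by ring.
have -> : d * (Y * x + X * y) ^ 2 =
    d * Y ^ 2 * x ^ 2 + d * y ^ 2 * X ^ 2 + 2 * d * X * Y * x * y by ring.
by rewrite normE IH; ring.
Qed.

Lemma pellX_gt0 d X Y m : 0 < X -> 0 < pellX d X Y m.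
Proof.
by move=> X0; elim: m => // m IH; rewrite pellXS addn_gt0 muln_gt0 X0 IH.
Qed.

Lemma pellX_lt d X Y m n : 1 < X -> m < n -> pellX d X Y m < pellX d X Y n.
Proof.
move=> X1; elim: n => // n IH; rewrite ltnS leq_eqVlt => /orP[/eqP->|/IH].
  by rewrite pellXS; have := pellX_gt0 d Y n (ltnW X1); nia.
move=> /leq_trans; apply.
by rewrite pellXS; have := pellX_gt0 d Y n (ltnW X1); nia.
Qed.

Lemma ltn_pellX d X Y m : 1 < X -> m < pellX d X Y m.
Proof.
move=> X1; elim: m => // m IH.
exact: leq_ltn_trans IH (pellX_lt _ _ _ (ltnSn m)).
Qed.

(** Every solution is a power of the fundamental one: otherwise divide by
    [X + Y sqrt d] and descend. *)
Lemma pell_complete d X Y x y : 0 < d -> fundamental_solution d X Y ->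
  x ^ 2 = d * y ^ 2 + 1 -> exists m, x = pellX d X Y m /\ y = pellY d X Y m.
Proof.
move=> d0 [/pell_solution_nat[X0 Y0 normE] minX].
elim/ltn_ind: y x => y IH x eq_xy.
have [y0|y_gt0] := posnP y.
  by exists 0; rewrite /pellX /pellY /=; split=> //; rewrite y0 in eq_xy; nia.
have x0 : 0 < x by nia.
have Xx : X <= x by apply: (minX x y); apply/pell_solution_nat.
have Yy : Y <= y.
  rewrite -leq_sqr -(leq_pmul2l d0); move: Xx; rewrite -leq_sqr; lia.
(* [X y - Y x] and [X x - d Y y] are the coordinates of the quotient of
   [x + y sqrt d] by [X + Y sqrt d] *)
have le1 : Y * x <= X * y.
  rewrite -leq_sqr !expnMn normE eq_xy.
  by move: Yy; rewrite -leq_sqr; nia.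
have lt2 : X * y - Y * x < y.
  suff : (X - 1) * y < Y * x by rewrite mulnBl mul1n; nia.
  rewrite -ltn_sqr !expnMn eq_xy.
  have : (X - 1) ^ 2 < d * Y ^ 2.
    have [k XE] : exists k, X = k + 1 by exists (X - 1); lia.
    by rewrite XE addnK in normE *; nia.
  by move: Y0; nia.
have lt3 : d * Y * y < X * x.
  by rewrite -ltn_sqr !expnMn normE eq_xy; nia.
have [b bE] : exists b, X * y = Y * x + b by exists (X * y - Y * x); lia.
have [a aE] : exists a, X * x = d * Y * y + a by exists (X * x - d * Y * y); lia.
have eqx : X * a + d * Y * b = x.
  have e1 : X * (X * x) = X * (d * Y * y) + X * a by rewrite aE mulnDr.
  have e2 : d * Y * (X * y) = d * Y * (Y * x) + d * Y * b by rewrite bE mulnDr.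
  have e3 : X ^ 2 * x = (d * Y ^ 2 + 1) * x by rewrite normE.
  by lia.
have eqy : Y * a + X * b = y.
  have e1 : Y * (X * x) = Y * (d * Y * y) + Y * a by rewrite aE mulnDr.
  have e2 : X * (X * y) = X * (Y * x) + X * b by rewrite bE mulnDr.
  have e3 : X ^ 2 * y = (d * Y ^ 2 + 1) * y by rewrite normE.
  by lia.
have lt_b : b < y by rewrite bE addKn in lt2.
have eq_ab : a ^ 2 = d * b ^ 2 + 1.
  have h : (X ^ 2) * a ^ 2 + d ^ 2 * Y ^ 2 * b ^ 2 =
     d * Y ^ 2 * a ^ 2 + d * X ^ 2 * b ^ 2 + 1.
    have := eq_xy; rewrite -eqx -eqy => /eqP; rewrite -(eqn_add2r 0) => /eqP; lia.
  by rewrite normE in h; lia.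
have [m [aE' bE']] := IH b lt_b a eq_ab.
by exists m.+1; rewrite pellXS pellYS -aE' -bE'.
Qed.

(** * Recovering the fundamental solution *)

Definition sumX d X Y r := \sum_(m < r.+1) pellX d X Y m.
Definition sumY d X Y r := \sum_(m < r.+1) pellY d X Y m.

Lemma sumXS d X Y r :
  sumX d X Y r.+1 = 1 + X * sumX d X Y r + d * Y * sumY d X Y r.
Proof.
rewrite /sumX big_ord_recl -addnA; congr (_ + _).
rewrite /sumX /sumY !big_distrr -big_split; apply: eq_bigr => m _ /=.
by rewrite /bump leq0n add1n pellXS.
Qed.

Lemma sumYS d X Y r : sumY d X Y r.+1 = Y * sumX d X Y r + X * sumY d X Y r.
Proof.
rewrite /sumY big_ord_recl add0n.
rewrite /sumX !big_distrr -big_split; apply: eq_bigr => m _ /=.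
by rewrite /bump leq0n add1n pellYS.
Qed.

Lemma sumX0 d X Y : sumX d X Y 0 = 1.
Proof. by rewrite /sumX big_ord1. Qed.

Lemma sumY0 d X Y : sumY d X Y 0 = 0.
Proof. by rewrite /sumY big_ord1. Qed.

(** With [e = X + Y sqrt d] and [s = 1 + e + ... + e ^ r = A + B sqrt d], this says
    that the rational part [c] of [c + B sqrt d = s' (s - 1)], [s'] the
    conjugate of [s], satisfies [Y c = (X + 1) B], that is
    [c + B sqrt d = e (c - B sqrt d)]. *)
Lemma sum_identity d X Y r : X ^ 2 = d * Y ^ 2 + 1 ->
  let A := sumX d X Y r in let B := sumY d X Y r in
  Y * A ^ 2 = (X + 1) * B + Y * A + d * Y * B ^ 2.
Proof.
move=> normE; elim: r => [|r] /=; first by rewrite sumX0 sumY0; lia.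
rewrite sumXS sumYS.
move: (sumX d X Y r) (sumY d X Y r) => A B IH.
have e1 : X ^ 2 * (Y * A ^ 2) = (d * Y ^ 2 + 1) * (Y * A ^ 2) by rewrite normE.
have e2 : X ^ 2 * (d * Y * B ^ 2) = (d * Y ^ 2 + 1) * (d * Y * B ^ 2).
  by rewrite normE.
have e3 : X ^ 2 * B = (d * Y ^ 2 + 1) * B by rewrite normE.
by lia.
Qed.

Lemma sum_remainder d X Y r : X ^ 2 = d * Y ^ 2 + 1 -> 0 < Y ->
  let A := sumX d X Y r in let B := sumY d X Y r in
  exists c, A ^ 2 = A + d * B ^ 2 + c /\ Y * c = (X + 1) * B.
Proof.
move=> normE Y0 A B; have := @sum_identity d X Y r normE; rewrite -/A -/B /= => idE.
have le_A : A + d * B ^ 2 <= A ^ 2 by rewrite -(leq_pmul2l Y0); lia.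
exists (A ^ 2 - (A + d * B ^ 2)); split; first by lia.
by rewrite mulnBr; lia.
Qed.

(** [(c ^ 2 + d B ^ 2) + 2 B c sqrt d = (c + B sqrt d) ^ 2] and
    [c ^ 2 - d B ^ 2 = (c + B sqrt d) (c - B sqrt d)]; their quotient is
    [(c + B sqrt d) / (c - B sqrt d) = X + Y sqrt d], so both divisions are exact. *)
Lemma pell_recovery d X Y A B c : 0 < d -> X ^ 2 = d * Y ^ 2 + 1 -> 0 < Y -> 0 < B ->
  A ^ 2 = A + d * B ^ 2 + c -> Y * c = (X + 1) * B ->
  let V := d * (B * B) in let c' := A * A - A - V in let D := c' * c' - V in
  (c' * c' + V) %/ D = X /\ (2 * B * c') %/ D = Y.
Proof.
move=> d0 normE Y0 B0 eqA eqc V c' D.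
have -> : c' = c by rewrite /c' /V; lia.
have X1 : 1 < X by nia.
have eqc2 : X * c = c + d * Y * B.
  apply/eqP; rewrite -(eqn_pmul2l Y0); apply/eqP.
  have e1 : X * (Y * c) = X * ((X + 1) * B) by rewrite eqc.
  have e2 : X ^ 2 * B = (d * Y ^ 2 + 1) * B by rewrite normE.
  by lia.
have DE : D = c * c - V by rewrite /D (_ : c' = c) //; rewrite /c' /V; lia.
have lt_V : V < c * c.
  rewrite -(ltn_pmul2l (_ : 0 < Y ^ 2)) ?sqrn_gt0 //.
  have -> : Y ^ 2 * (c * c) = (X + 1) ^ 2 * B ^ 2 by rewrite -expnMn -eqc; lia.
  have -> : Y ^ 2 * V = (d * Y ^ 2) * B ^ 2 by rewrite /V; lia.
  have -> : (d * Y ^ 2) = X ^ 2 - 1 by lia.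
  by rewrite ltn_mul2r; have := B0; rewrite -sqrn_gt0 => ->; nia.
have D0 : 0 < D by lia.
split.
  have -> : c * c + V = X * D; last by rewrite mulnK.
  rewrite DE mulnBr /V.
  have e1 : X * c * c = (c + d * Y * B) * c by rewrite eqc2.
  have e2 : d * B * (Y * c) = d * B * ((X + 1) * B) by rewrite eqc.
  by lia.
have -> : 2 * B * c = Y * D; last by rewrite mulnK.
rewrite DE mulnBr /V.
have e1 : Y * c * c = (X + 1) * B * c by rewrite eqc.
have e2 : B * (X * c) = B * (c + d * Y * B) by rewrite eqc2.
by lia.
Qed.

Lemma sumY_le_pellX d X Y r : 1 < d -> X ^ 2 = d * Y ^ 2 + 1 -> 0 < Y ->
  sumY d X Y r <= pellX d X Y r.
Proof.
move=> d1 normE Y0; elim: r => [|r IH]; first by rewrite sumY0.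
have lt_YX : Y < X by rewrite -ltn_sqr; nia.
have le_X : X <= d * Y.
  rewrite -leq_sqr expnMn normE -[d ^ 2]mulnn -mulnA.
  have : 0 < d * Y ^ 2 by rewrite muln_gt0 sqrn_gt0 Y0; lia.
  by move: (d * Y ^ 2) => z; nia.
have -> : sumY d X Y r.+1 = sumY d X Y r + pellY d X Y r.+1.
  by rewrite /sumY big_ord_recr.
rewrite pellXS pellYS.
move: (pellX _ _ _ _) (pellY _ _ _ _) IH => x y IH.
have : X * y <= d * Y * y by rewrite leq_mul2r le_X orbT.
have : Y.+1 * x <= X * x by rewrite leq_mul2r lt_YX orbT.
by lia.
Qed.

(** [A - B sqrt d] is positive, as a sum of powers of the number [X - Y sqrt d],
    which lies between 0 and 1. The upper bound amounts to [(2A - 1) ^ 2 <= d (2B + 1) ^ 2 - d + 1], hence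
    [A / sqrt d] exceeds [B] by less than [1/2 + 1 / (2 sqrt d)]. *)
Lemma sum_bounds d X Y r : 1 < d -> X ^ 2 = d * Y ^ 2 + 1 -> 0 < Y ->
  d * sumY d X Y r ^ 2 <= sumX d X Y r ^ 2
    <= sumX d X Y r + d * sumY d X Y r + d * sumY d X Y r ^ 2.
Proof.
move=> d1 normE Y0; have [c [eqA eqc]] := sum_remainder r normE Y0.
move: (sumX d X Y r) (sumY d X Y r) eqA eqc => A B eqA eqc.
suff : c <= d * B by lia.
have lt_YX : Y < X by rewrite -ltn_sqr; nia.
have le_X : X + 1 <= d * Y.
  have [k XE] : exists k, X = k + 1 by exists (X - 1); lia.
  rewrite -(@leq_pmul2r k); last by nia.
  have -> : (X + 1) * k = d * Y * Y by rewrite XE in normE *; lia.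
  by rewrite leq_mul2l; lia.
rewrite -(leq_pmul2l Y0) eqc.
have -> : Y * (d * B) = d * Y * B by lia.
by rewrite leq_mul2r le_X orbT.
Qed.

(** [A / sqrt d] exceeds [B] by so little that [A] times
    [sqrt ((2K + 1) / (2dK + 1))], which is slightly more than [A / sqrt d], is
    still less than [B + 1]. The worst case is [K = B + 1 = t], where the claim
    follows from [(A + t) ^ 2 < (2d + 2) t ^ 2]; as [A] is about [t sqrt d], this
    reflects [(sqrt d - 1) ^ 2 > 0]. *)
Lemma rounding_margin d K A B : 1 < d -> B < K ->
  A ^ 2 <= A + d * B + d * B ^ 2 ->
  A ^ 2 * (2 * K + 1) < (B + 1) ^ 2 * (2 * (d * K) + 1).
Proof.
move=> d1 BK hA; have [t tE] : exists t, t = B + 1 by exists (B + 1).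
have le_A : A <= d * t.
  rewrite leqNgt; apply/negP => lt_A.
  have : d * t * (d * t) <= A * (A - 1) by apply: leq_mul; lia.
  have -> : A * (A - 1) = A ^ 2 - A by rewrite mulnBr muln1 mulnn.
  have -> : d * t * (d * t) = d * (d * t * t) by ring.
  have : d * B + d * B ^ 2 < d * t * t by rewrite tE; lia.
  have : d * t * t <= d * (d * t * t) by rewrite leq_pmull //; lia.
  by lia.
have main : (A + t) ^ 2 < (2 * d + 2) * t ^ 2.
  have BE : B = t - 1 by lia.
  have t0 : 0 < t by lia.
  have hA' : A ^ 2 + d * t <= A + d * t ^ 2.
    have -> : t ^ 2 = B ^ 2 + 2 * B + 1 by rewrite tE; lia.
    by rewrite {1}tE; lia.
  have [eq_At|ne_At] := eqVneq A t; first by rewrite eq_At; nia.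
  have lt_sq : 2 * A * t < A ^ 2 + t ^ 2.
    by rewrite -mulnA; have := nat_Cauchy A t; rewrite leq_eqVlt; nia.
  have -> : (A + t) ^ 2 = A ^ 2 + 2 * A * t + t ^ 2 by ring.
  have -> : (2 * d + 2) * t ^ 2 = 2 * (d * t ^ 2) + 2 * t ^ 2 by ring.
  by lia.
have [e eE] : exists e, d * t = A + e by exists (d * t - A); lia.
have le_tK : t * e <= K * e by rewrite leq_mul2r; lia.
have le_Ae : A ^ 2 + e <= d * t ^ 2.
  have -> : d * t ^ 2 = d * B ^ 2 + d * B + d * t by rewrite tE; ring.
  by lia.
have le_K : K * A ^ 2 + K * e <= d * K * t ^ 2.
  by rewrite -mulnDr [d * K]mulnC -mulnA leq_mul2l le_Ae orbT.
have eq_te : d * t ^ 2 = t * A + t * e by rewrite -mulnDr -eE; ring.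
rewrite -tE; move: main; have -> : (A + t) ^ 2 = A ^ 2 + 2 * (t * A) + t ^ 2 by ring.
have -> : (2 * d + 2) * t ^ 2 = 2 * (d * t ^ 2) + 2 * t ^ 2 by ring.
have -> : A ^ 2 * (2 * K + 1) = 2 * (K * A ^ 2) + A ^ 2 by ring.
have -> : t ^ 2 * (2 * (d * K) + 1) = 2 * (d * K * t ^ 2) + t ^ 2 by ring.
by lia.
Qed.

(** * The division by the square root of d *)

Lemma central_binS n :
  n.+1 * 'C(2 * n.+1, n.+1) = 2 * (2 * n + 1) * 'C(2 * n, n).
Proof.
have central_fact m : 'C(2 * m, m) * (m`! * m`!) = (2 * m)`!.
  have le_m : m <= 2 * m by lia.
  by have := bin_fact le_m; have -> : 2 * m - m = m by lia.
have := central_fact n.+1; have -> : 2 * n.+1 = (2 * n).+2 by lia.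
rewrite !factS -central_fact.
have : 0 < n.+1 * (n`! * n`!) by rewrite !muln_gt0 fact_gt0.
move: ('C((2 * n).+2, n.+1)) ('C(2 * n, n)) (n`!) => x y f f0 eqf.
by apply/eqP; rewrite -(eqn_pmul2r f0); apply/eqP; lia.
Qed.

Lemma central_binS_sqr n :
  n.+1 ^ 2 * 'C(2 * n.+1, n.+1) ^ 2 = 4 * (2 * n + 1) ^ 2 * 'C(2 * n, n) ^ 2.
Proof. by rewrite -expnMn central_binS !expnMn. Qed.

(** With [b n = 'C(2n, n) / 4 ^ n], the sequence [n (b n) ^ 2] increases and
    [(2n + 1) (b n) ^ 2] decreases (both tend to [1 / pi] up to a factor 2);
    hence [b (d K) / b K] approximates [1 / sqrt d]. *)
Lemma central_bin_ratio n k :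
  n * 16 ^ k * 'C(2 * n, n) ^ 2 <= (n + k) * 'C(2 * (n + k), n + k) ^ 2 /\
  (2 * (n + k) + 1) * 'C(2 * (n + k), n + k) ^ 2
     <= (2 * n + 1) * 16 ^ k * 'C(2 * n, n) ^ 2.
Proof.
elim: k => [|k [IHlo IHhi]]; first by rewrite addn0 expn0 !muln1.
rewrite addnS expnS; move: (n + k) IHlo IHhi => N IHlo IHhi.
have := central_binS_sqr N.
move: ('C(2 * N.+1, N.+1)) => c'.
move: ('C(2 * N, N)) IHlo IHhi => c IHlo IHhi eqc; split.
  rewrite -(leq_pmul2l (ltn0Sn N)).
  have -> : N.+1 * (N.+1 * c' ^ 2) = 4 * (2 * N + 1) ^ 2 * c ^ 2.
    by rewrite -eqc; ring.
  have : N.+1 * 16 * (n * 16 ^ k * 'C(2 * n, n) ^ 2) <= N.+1 * 16 * (N * c ^ 2).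
    by rewrite leq_mul2l IHlo orbT.
  by lia.
rewrite -(leq_pmul2l (_ : 0 < N.+1 ^ 2)) ?sqrn_gt0 //.
have -> : N.+1 ^ 2 * ((2 * N.+1 + 1) * c' ^ 2) =
    (2 * N + 3) * (4 * (2 * N + 1) ^ 2 * c ^ 2) by rewrite -eqc; ring.
have : N.+1 ^ 2 * 16 * ((2 * N + 1) * c ^ 2)
    <= N.+1 ^ 2 * 16 * ((2 * n + 1) * 16 ^ k * 'C(2 * n, n) ^ 2).
  by rewrite leq_mul2l IHhi orbT.
by lia.
Qed.

(** The quotient is the floor of [A rho], where [rho = b (d K) / b K] lies between
    [1 / sqrt d] and [sqrt ((2K + 1) / (2dK + 1))] by [central_bin_ratio]; the
    hypotheses compare [A] times these two bounds with [B] and [B + 1]. *)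
Lemma central_bin_quotient d K A B : 1 < d -> 0 < K -> d * B ^ 2 <= A ^ 2 ->
  A ^ 2 * (2 * K + 1) < (B + 1) ^ 2 * (2 * (d * K) + 1) ->
  (A * 'C(2 * (d * K), d * K)) %/ (2 ^ (2 * (d * K) - 2 * K) * 'C(2 * K, K)) = B.
Proof.
move=> d1 K0 lo hi.
have le_K : K <= d * K by rewrite leq_pmull; lia.
have [r_lo r_hi] := central_bin_ratio K (d * K - K).
rewrite subnKC // in r_lo r_hi.
set a := 2 ^ _ * _; set c := 'C(2 * (d * K), d * K).
have a0 : 0 < a by rewrite muln_gt0 expn_gt0 bin_gt0; lia.
have a2 : a ^ 2 = 16 ^ (d * K - K) * 'C(2 * K, K) ^ 2.
  rewrite expnMn -expnM; congr (_ * _).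
  by rewrite -[16]/(2 ^ 4) -expnM; congr (_ ^ _); lia.
clearbody a; rewrite -mulnA -a2 -/c in r_lo; rewrite -mulnA -a2 -/c in r_hi.
have le_a : a ^ 2 <= d * c ^ 2.
  by rewrite -(leq_pmul2l K0) (leq_trans r_lo) // mulnA [K * d]mulnC.
apply/eqP; rewrite eqn_leq -ltnS ltn_divLR // leq_divRL //; apply/andP; split.
  rewrite -[B.+1]addn1 -ltn_sqr !expnMn.
  rewrite -(ltn_pmul2r (_ : 0 < 2 * (d * K) + 1)); last by lia.
  apply: (@leq_ltn_trans (A ^ 2 * ((2 * K + 1) * a ^ 2))).
    by rewrite -mulnA leq_mul2l [c ^ 2 * _]mulnC r_hi orbT.
  have -> : A ^ 2 * ((2 * K + 1) * a ^ 2) = A ^ 2 * (2 * K + 1) * a ^ 2 by ring.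
  have -> : (B + 1) ^ 2 * a ^ 2 * (2 * (d * K) + 1) =
            (B + 1) ^ 2 * (2 * (d * K) + 1) * a ^ 2 by ring.
  by rewrite ltn_mul2r sqrn_gt0 a0.
rewrite -leq_sqr !expnMn.
apply: (@leq_trans (B ^ 2 * (d * c ^ 2))); first by rewrite leq_mul2l le_a orbT.
by rewrite mulnA [B ^ 2 * d]mulnC leq_mul2r lo orbT.
Qed.

(** * The counted solutions *)

Lemma last_pellX_below d X Y K : 1 < X -> X < K ->
  exists r, [/\ 0 < r, pellX d X Y r < K & K <= pellX d X Y r.+1].
Proof.
move=> X1 XK; pose T r := pellX d X Y r < K.
have T1 : T 1 by rewrite /T pellXS /pellX /pellY /= muln0 addn0 muln1.
have bT r : T r -> r <= K by move=> /(ltn_trans (ltn_pellX d Y r X1))/ltnW.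
case: (ex_maxnP (ex_intro T 1 T1) bT) => r Tr max_r.
exists r; split=> //; first exact: max_r.
by rewrite leqNgt; apply/negP => /max_r; rewrite ltnn.
Qed.

(** A first coordinate determines the second one, so each inner sum is 0 or 1, and
    [pell_complete] identifies the [i] with value 1 as
    [pellX 0, ..., pellX r]. *)
Lemma sum_solutions d X Y K r : 1 < d -> fundamental_solution d X Y ->
  pellX d X Y r < K -> K <= pellX d X Y r.+1 ->
  \sum_(i < K) i * \sum_(j < K) (i ^ 2 == d * j ^ 2 + 1) = sumX d X Y r.
Proof.
move=> d1 fund rK Kr.
have [/pell_solution_nat[X0 Y0 normE] _] := fund.
have X1 : 1 < X by nia.
pose S := [seq pellX d X Y m | m <- iota 0 r.+1].
have injX : injective (pellX d X Y).
  move=> m n eq_mn; case: (ltngtP m n) => // /(pellX_lt d Y X1).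
    by rewrite eq_mn ltnn.
  by rewrite eq_mn ltnn.
have memS i : i < K ->
    \sum_(j < K) (i ^ 2 == d * j ^ 2 + 1) = (i \in S).
  move=> iK; case: (boolP (i \in S)) => [/mapP[m]|notS].
    rewrite mem_iota => /andP[_ lt_mr] iE.
    have := pell_norm m normE; rewrite -iE; set y := pellY _ _ _ _ => eq_iy.
    have yK : y < K by nia.
    transitivity (\sum_(j < K) (j == y :> nat)); last by rewrite sum_ord_eq yK.
    apply: eq_bigr => j _.
    rewrite eq_iy eqn_add2r eqn_pmul2l 1?ltnW // eqn_sqr eq_sym //.
  rewrite big1 // => j _; apply/eqP; rewrite eqb0; apply: contra notS => /eqP eq_ij.
  have [m [iE _]] := pell_complete (ltnW d1) fund eq_ij.
  apply/mapP; exists m => //; rewrite mem_iota add0n /=.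
  rewrite ltnNge; apply/negP => lt_rm.
  have : pellX d X Y r.+1 <= pellX d X Y m.
    by move: lt_rm; rewrite leq_eqVlt => /orP[/eqP<-|/(pellX_lt d Y X1)/ltnW].
  by rewrite -iE; lia.
transitivity (\sum_(i <- iota 0 K | i \in S) i).
  have -> : iota 0 K = index_iota 0 K by rewrite /index_iota subn0.
  rewrite [RHS]big_mkcond big_mkord.
  by apply: eq_bigr => i _; rewrite memS //; case: ifP => _; rewrite ?muln1 ?muln0.
transitivity (\sum_(i <- S) i); last first.
  by rewrite /S big_map -[iota _ _]/(index_iota 0 r.+1) big_mkord.
rewrite -big_filter; apply: perm_big; apply: uniq_perm.
- by rewrite filter_uniq ?iota_uniq.
- by rewrite map_inj_uniq ?iota_uniq.
move=> i; rewrite mem_filter mem_iota add0n /=.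
case: (boolP (i \in S)) => //= /mapP[m]; rewrite mem_iota add0n => /andP[_ lt_mr] ->.
have : pellX d X Y m <= pellX d X Y r.
  by move: lt_mr; rewrite ltnS leq_eqVlt => /orP[/eqP<-|/(pellX_lt d Y X1)/ltnW].
by lia.
Qed.

(** * Sizes of intermediate values *)

(** The weak inequality makes exponents add up under products and gives [2 ^ k]
    the exponent [k]. *)
Definition fits n v := v <= 2 ^ n.

(** A Hoare triple that also carries a common size bound for the trace. *)
Definition computes n (T : Type) (c : Defs.comp T) (R : T -> Prop) :=
  all (fits n) (intermediates c) /\ R (result c).

Lemma fits_leq m n v : fits m v -> m <= n -> fits n v.
Proof. by move=> /leq_trans h le_mn; apply: h; rewrite leq_exp2l. Qed.

Lemma fits_trans n u v : fits n v -> u <= v -> fits n u.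
Proof. by move=> hv /leq_trans; apply. Qed.

Lemma fits_self n : fits n n.
Proof. exact/ltnW/ltn_expl. Qed.

Lemma fitsD m n u v : fits m u -> fits n v -> fits (m + n + 1) (u + v).
Proof.
rewrite /fits => hu hv.
have : 2 ^ m <= 2 ^ (m + n) by rewrite leq_exp2l ?leq_addr.
have : 2 ^ n <= 2 ^ (m + n) by rewrite leq_exp2l ?leq_addl.
by rewrite [2 ^ (_ + 1)]expnD expn1; lia.
Qed.

Lemma fitsB m u v : fits m u -> fits m (u - v).
Proof. by move/fits_trans; apply; rewrite leq_subr. Qed.

Lemma fitsM m n u v : fits m u -> fits n v -> fits (m + n) (u * v).
Proof. by move=> hu hv; rewrite /fits expnD leq_mul. Qed.

Lemma fits_div m u v : fits m u -> fits m (u %/ v).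
Proof. by move/fits_trans; apply; rewrite leq_div. Qed.

Lemma fits_mod m u v : fits m u -> fits m (u %% v).
Proof. by move/fits_trans; apply; rewrite leq_mod. Qed.

Lemma fitsX m u k : fits m u -> fits (m * k) (u ^ k).
Proof. by move=> hu; case: k => [|k]; rewrite /fits ?muln0 // expnM leq_exp2r. Qed.

Lemma fits_exp2 k : fits k (2 ^ k).
Proof. exact: leqnn. Qed.

Lemma computes_set n m e T (k : nat -> Defs.comp T) R :
  all (fits m) (trace e) -> m <= n ->
  (forall x, x = eval e -> computes n (k x) R) ->
  computes n (bind (run e) k) R.
Proof.
move=> he le_mn /(_ _ erefl)[hk hR]; split=> //.
rewrite all_cat hk andbT; apply: sub_all he => v hv; exact: fits_leq hv le_mn.
Qed.

Lemma computes_bind n S T (c : Defs.comp S) (k : S -> Defs.comp T) Q R :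
  computes n c Q -> (forall x, Q x -> computes n (k x) R) ->
  computes n (bind c k) R.
Proof.
move=> [hc /[swap] h /h[hk hR]]; split=> //.
by rewrite all_cat hc hk.
Qed.

(** Reads a size exponent off the shape of an expression and the [fits] hypotheses
    on its variables; a numeral [c] gets the exponent [c]. *)
Ltac fits_value :=
  first [ eassumption |
  lazymatch goal with
  | |- is_true (fits _ (addn _ _)) => apply: fitsD; fits_value
  | |- is_true (fits _ (subn _ _)) => apply: fitsB; fits_value
  | |- is_true (fits _ (muln _ _)) => apply: fitsM; fits_value
  | |- is_true (fits _ (divn _ _)) => apply: fits_div; fits_value
  | |- is_true (fits _ (modn _ _)) => apply: fits_mod; fits_value
  | |- is_true (fits _ (expn _ _)) => first [exact: fits_exp2 | apply: fitsX; fits_value]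
  | |- _ => exact: fits_self
  end ].

(** Sizes are compared from inequalities alone; the equations that define the
    variables are towers of powers. *)
Ltac size_lia :=
  repeat match goal with
  | H : @eq nat _ _ |- _ => clear H
  | H : is_true (fits _ _) |- _ => clear H
  end; lia.

Ltac fits_trace :=
  rewrite /=; repeat (apply/andP; split); try done;
  (eapply fits_leq; [ fits_value | try first [size_lia | lia] ]).

Lemma subG02_computes n m Q K t ZQ0 :
  4 < Q -> 1 < K -> t = K - 1 -> fits m Q ->
  (if ZQ0 is Some Z then Z = Q ^ K else true) ->
  m * K + 5 * m + 8 * K + 10 <= n ->
  computes n (subG02 Q K t ZQ0)
    (fun r => [/\ r = (\sum_(i < K) Q ^ i, \sum_(i < K) i ^ 2 * Q ^ i),
                  fits (m * K) r.1 & fits (m * K + 3 * m + 2 * K + 5) r.2]).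
Proof.
move=> Q4 K1 tE hQ ZQE hn; rewrite /subG02.
have ht : fits K t by rewrite tE; apply/fitsB/fits_self.
apply: (computes_set (m := m)) => [||u uE]; [by fits_trace|lia|].
have hu : fits m u by rewrite uE; apply: fitsB.
apply: (computes_bind (Q := fun Z => Z = Q ^ K)).
  case: ZQ0 ZQE => [Z|] ZQE; split=> //=; rewrite andbT.
  by apply: fits_leq (fitsX K hQ) _; lia.
move=> Z ZE; have hZ : fits (m * K) Z by rewrite ZE; apply: fitsX.
apply: (computes_set (m := m + K)) => [||v vE]; [by fits_trace|lia|].
have hv : fits (m + K) v by rewrite vE; apply: fitsM.
apply: (computes_set (m := m + 3)) => [||Qp QpE]; [by fits_trace|lia|].
have hQp : fits (m + 3) Qp by rewrite QpE; fits_trace.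
apply: (computes_set (m := 3 * m)) => [||u3 u3E]; [by fits_trace|lia|].
apply: (computes_set (m := m * K)) => [||G0 G0E]; [by fits_trace|lia|].
apply: (computes_set (m := m + K)) => [||z zE]; [by fits_trace|lia|].
have hz : fits (m + K) z by rewrite zE; apply: fitsB.
apply: (computes_set (m := 3 * m + 2 * K + 5)) => [||g2 g2E]; [by fits_trace|lia|].
have hg2 : fits (3 * m + 2 * K + 5) g2 by rewrite g2E; fits_trace.
apply: (computes_set (m := m * K + 3 * m + 2 * K + 5)) => [||G2 G2E].
- by fits_trace.
- by lia.
split=> //=; split; [rewrite G0E G2E /=|by rewrite G0E; fits_trace|by rewrite G2E; fits_trace].
rewrite g2E zE QpE u3E vE uE ZE /= tE.
by rewrite geometric_quotient ?geometric_square_quotient //; lia.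
Qed.

Lemma subC_computes n m k d K A B p :
  1 < d -> 0 < K -> p = 2 ^ m -> 2 * (d * K) < m -> fits k A ->
  d * B ^ 2 <= A ^ 2 ->
  A ^ 2 * (2 * K + 1) < (B + 1) ^ 2 * (2 * (d * K) + 1) ->
  2 * d * K * (m + 2) + m * K * d + 2 * d * K + 2 * K + d + k <= n ->
  computes n (subC d K A p (p ^ K)) (fun r => r = B /\ fits (k + 2 * d * K * (m + 2)) r).
Proof.
move=> d1 K0 pE lt_m hA lo hi hn; rewrite /subC.
have quotE := central_bin_quotient d1 K0 lo hi; clear lo hi.
have le_K : K <= d * K by rewrite leq_pmull; lia.
have small a i : 0 < a -> a <= m -> 'C(a, i) < p.
  move=> a0 le_am; apply: leq_trans (ltn_bin_exp2 i a0) _.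
  by rewrite pE leq_exp2l.
have digit_K : (p + 1) ^ (2 * K) %/ p ^ K %% p = 'C(2 * K, K).
  by apply: binomial_digit => [|i]; [|apply: small]; clear -K0 le_K lt_m; lia.
have digit_dK : (p + 1) ^ (d * (2 * K)) %/ (p ^ K) ^ d %% p = 'C(2 * (d * K), d * K).
  rewrite -expnM [K * d]mulnC [d * (2 * K)]mulnCA.
  by apply: binomial_digit => [|i]; [|apply: small]; clear -K0 le_K lt_m; lia.
have hd := fits_self d.
have hp : fits m p by rewrite pE; apply: fits_exp2.
have le_dmK : m * K <= m * K * d by rewrite leq_pmulr; lia.
have le_Km : K * (m + 2) <= d * K * (m + 2) by rewrite leq_mul2r le_K orbT.
have le_m2 : m + 2 <= d * K * (m + 2) by rewrite leq_pmull // muln_gt0 K0 ltnW.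
clear small pE lt_m.
apply: (computes_set (m := K + 2)) => [||h /= ->]; [by fits_trace|size_lia|].
apply: (computes_set (m := m + 2)) => [||zc zcE]; [by fits_trace|size_lia|].
have hzc : fits (m + 2) zc by rewrite zcE; fits_trace.
apply: (computes_set (m := (m + 2) * (2 * K))) => [||cK cKE].
- by fits_trace.
- by size_lia.
have hcK : fits ((m + 2) * (2 * K)) cK by rewrite cKE; fits_trace.
have h2K := fits_self (2 * K).
apply: (computes_set (m := d + 2 * K)) => [||Hc /= ->]; [by fits_trace|size_lia|].
apply: (computes_set (m := (m + 2) * (d * (2 * K)) + m * K * d)) => [||cdK cdKE].
- by fits_trace.
- by size_lia.
have hcdK : fits ((m + 2) * (d * (2 * K))) cdK by rewrite cdKE; fits_trace.
have hHc := fits_self (d * (2 * K)).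
apply: (computes_set (m := d * (2 * K) + (m + 2) * (2 * K))) => [||ac acE].
- rewrite /= !andbT; apply/and3P; split.
  + by fits_trace.
  + by apply: fits_leq (fits_exp2 _) _; size_lia.
  + by fits_trace.
- by size_lia.
apply: (computes_set (m := k + 2 * d * K * (m + 2))) => [||r rE].
- by fits_trace.
- by size_lia.
have hr : fits (k + 2 * d * K * (m + 2)) r by rewrite rE; fits_trace.
split=> //=; split=> //; rewrite rE /= acE cdKE cKE zcE /= digit_K digit_dK.
by rewrite [d * (2 * K)]mulnCA quotE.
Qed.

Lemma subR_computes n k d X Y A B c :
  0 < d -> X ^ 2 = d * Y ^ 2 + 1 -> 0 < Y -> 0 < B ->
  A ^ 2 = A + d * B ^ 2 + c -> Y * c = (X + 1) * B ->
  fits k A -> fits k B -> 8 * k + 2 * d + 10 <= n ->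
  computes n (subR d A B) (fun r => r = (X, Y)).
Proof.
move=> d0 normE Y0 B0 eqA eqc hA hB hn; rewrite /subR.
have hd := fits_self d.
apply: (computes_set (m := d + 2 * k)) => [||VB VE]; [by fits_trace|lia|].
have hV : fits (d + 2 * k) VB by rewrite VE; fits_trace.
apply: (computes_set (m := 2 * k)) => [||c' cE]; [by fits_trace|lia|].
have hc : fits (2 * k) c' by rewrite cE; fits_trace.
apply: (computes_set (m := 4 * k)) => [||Vc VcE]; [by fits_trace|lia|].
have hVc : fits (4 * k) Vc by rewrite VcE; fits_trace.
apply: (computes_set (m := 4 * k)) => [||Dc DE]; [by fits_trace|lia|].
apply: (computes_set (m := 6 * k + d + 1)) => [||X' XE]; [by fits_trace|lia|].
apply: (computes_set (m := 3 * k + 2)) => [||Y' YE]; [by fits_trace|lia|].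
split=> //=; rewrite XE YE /= DE VcE /= cE VE /=.
by have /= [-> ->] := pell_recovery d0 normE Y0 B0 eqA eqc.
Qed.

(** * The packed integer *)

Definition entry_row d w K i := \sum_(j < K) ((2 ^ w) ^ 3) ^ j * entry d w i j.

(** The sums [G0, G2] of the two bases combine to the double sum over [i, j], since
    [P + 2 - i ^ 2 + d j ^ 2] separates the variables. *)
Lemma packed_sum d w K q Q : (forall i, i < K -> i ^ 2 <= 2 ^ w) -> q = (2 ^ w) ^ 3 ->
  (2 ^ w - 1) * ((\sum_(j < K) q ^ j) * ((2 ^ w + 2) * (\sum_(i < K) Q ^ i)
      - \sum_(i < K) i ^ 2 * Q ^ i)
    + (\sum_(i < K) Q ^ i) * (d * \sum_(j < K) j ^ 2 * q ^ j))
  = \sum_(i < K) Q ^ i * entry_row d w K i.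
Proof.
move=> small qE.
have -> : (2 ^ w + 2) * (\sum_(i < K) Q ^ i) - \sum_(i < K) i ^ 2 * Q ^ i
    = \sum_(i < K) (2 ^ w + 2 - i ^ 2) * Q ^ i.
  suff -> : (2 ^ w + 2) * (\sum_(i < K) Q ^ i) =
    \sum_(i < K) (2 ^ w + 2 - i ^ 2) * Q ^ i + \sum_(i < K) i ^ 2 * Q ^ i.
    by rewrite addnK.
  rewrite big_distrr -big_split; apply: eq_bigr => i _ /=.
  by rewrite -mulnDl subnK //; have := small i (ltn_ord i); lia.
have rowE i : entry_row d w K i = (2 ^ w - 1) *
    ((2 ^ w + 2 - i ^ 2) * (\sum_(j < K) q ^ j) + d * \sum_(j < K) j ^ 2 * q ^ j).
  rewrite /entry_row -qE !big_distrr -big_split big_distrr; apply: eq_bigr => j _.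
  by rewrite /entry /=; ring.
rewrite (eq_bigr _ (fun (i : 'I_K) _ => congr1 (muln (Q ^ i)) (rowE i))).
move: (\sum_(j < K) q ^ j) (\sum_(j < K) j ^ 2 * q ^ j) => V0 V2.
rewrite big_distrr big_distrl -big_split big_distrr; apply: eq_bigr => i _ /=.
by ring.
Qed.

Lemma sum_ord_triangular K : (\sum_(i < K) i) * 2 = K * (K - 1).
Proof.
elim: K => [|K IH]; first by rewrite big_ord0.
rewrite big_ord_recr /= mulnDl IH; by case: K {IH} => [|K] //; rewrite !subn1 /=; lia.
Qed.

Lemma sigma_eq K : (K * K * (K - 1)) %/ 2 = K * \sum_(i < K) i.
Proof. by rewrite -mulnA -sum_ord_triangular mulnA mulnK. Qed.

(** The first sum is the constant that the program subtracts, the second one adds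
    up the first coordinates of the solutions below [K], and the third one
    disappears in the division by [w]. *)
Lemma weight_packed d w K : 1 < w -> (forall i, i < K -> i ^ 2 <= 2 ^ w) ->
  (forall j, j < K -> d * j ^ 2 + 2 <= 2 ^ w) ->
  weight (stacked (((2 ^ w) ^ 3) ^ K) K (entry_row d w K)) =
    (K * \sum_(i < K) i
     + \sum_(i < K) i * \sum_(j < K) (i ^ 2 == d * j ^ 2 + 1)) * w
    + \sum_(i < K) i * \sum_(j < K) excess d i j.
Proof.
move=> w1 smallX smallY.
have row_lt i : i < K -> entry_row d w K i < ((2 ^ w) ^ 3) ^ K.
  move=> iK; apply: (sum_digits_lt (a := entry d w i)) => j jK.
  by apply/ltnW/entry_small => //; apply: smallY.
have powE : ((2 ^ w) ^ 3) ^ K = 2 ^ (w * 3 * K) by rewrite -!expnM mulnA.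
rewrite powE weight_stacked; last by move=> i; rewrite -powE; apply: row_lt.
rewrite mulnDl !big_distrr !big_distrl -!big_split; apply: eq_bigr => i _ /=.
have -> : weight (entry_row d w K i) = \sum_(j < K) weight (entry d w i j).
  rewrite /entry_row -expnM (weight_sum_digits (a := entry d w i)) // => j jK.
  by rewrite expnM; apply/ltnW/entry_small => //; apply: smallY.
have -> : K * i * w + i * (\sum_(j < K) (i ^ 2 == d * j ^ 2 + 1)) * w
    + i * (\sum_(j < K) excess d i j) =
  i * (K * w + (\sum_(j < K) (i ^ 2 == d * j ^ 2 + 1)) * w
    + \sum_(j < K) excess d i j) by ring.
congr (_ * _); rewrite -[X in X * w]card_ord -sum_nat_const big_distrl -!big_split.
apply: eq_bigr => j _ /=; apply: weight_entry; first exact: ltnW.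
  exact: smallX.
exact: smallY.
Qed.

(** * The whole program *)

Lemma leq_sqr_exp2 n : 4 <= n -> n ^ 2 <= 2 ^ n.
Proof.
move=> n4; have [k ->] : exists k, n = k + 4 by exists (n - 4); lia.
elim: k => // k IH; have -> : 2 ^ (k.+1 + 4) = 2 * 2 ^ (k + 4) by rewrite addSn expnS.
by nia.
Qed.

(** The sums [A] and [B] of the coordinates of all solutions below [K] satisfy
    what the last two subroutines require of them. *)
Lemma solution_sums d X Y K : 1 < d -> fundamental_solution d X Y -> X < K ->
  exists A B c,
  [/\ \sum_(i < K) i * \sum_(j < K) (i ^ 2 == d * j ^ 2 + 1) = A, 0 < A & 0 < B] /\
  [/\ A ^ 2 = A + d * B ^ 2 + c, Y * c = (X + 1) * B &
      A ^ 2 * (2 * K + 1) < (B + 1) ^ 2 * (2 * (d * K) + 1)].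
Proof.
move=> d1 fund XK; have [/pell_solution_nat[X0 Y0 normE] _] := fund.
have X1 : 1 < X by nia.
have [r [r0 rK Kr]] := last_pellX_below d Y X1 XK.
have [c [eqA eqc]] := sum_remainder r normE Y0.
exists (sumX d X Y r), (sumY d X Y r), c; split; split=> //.
- exact: sum_solutions.
- by rewrite /sumX big_ord_recl.
- by case: r r0 {rK Kr eqA eqc} => // r _; rewrite sumYS addn_gt0 muln_gt0 Y0 /sumX big_ord_recl.
- apply: rounding_margin => //.
    exact: leq_ltn_trans (sumY_le_pellX r d1 normE Y0) rK.
  by have /andP[] := sum_bounds r d1 normE Y0.
Qed.

(** [d < X ^ 2 < K ^ 2], so every [i ^ 2] and [d j ^ 2] is below [K ^ 4], which is tiny
    compared with [2 ^ w]. *)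
Lemma entry_bounds d X Y K w : fundamental_solution d X Y -> X < K ->
  64 <= K -> w = (2 * K) ^ 3 ->
  [/\ d < K ^ 2, forall i, i < K -> i ^ 2 <= 2 ^ w,
      forall j, j < K -> d * j ^ 2 + 2 <= 2 ^ w & 1 + d * K ^ 2 < 2 ^ (2 * K)].
Proof.
move=> [/pell_solution_nat[X0 Y0 normE] _] XK K64 wE.
have lt_dK : d < K ^ 2.
  have : d <= d * Y ^ 2 by rewrite leq_pmulr // sqrn_gt0.
  by move: XK; rewrite -ltn_sqr; lia.
have dK4 : d.+1 * K ^ 2 <= K ^ 4.
  by rewrite [K ^ 4](expnD K 2 2) leq_mul2r lt_dK orbT.
clear normE Y0 X0 XK.
have K2 : K <= K ^ 2 by rewrite -mulnn leq_pmulr; lia.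
have K4 : K ^ 4 <= 2 ^ (2 * K).
  by rewrite [2 * K]mulnC [2 ^ _]expnM [K ^ 4](expnM K 2 2) leq_sqr leq_sqr_exp2; lia.
have K4w : K ^ 4 <= 2 ^ w.
  apply: leq_trans K4 _; rewrite leq_exp2l // wE -{1}(expn1 (2 * K)).
  by rewrite leq_pexp2l; lia.
split=> // [i iK|j jK|]; last by lia.
  apply: leq_trans K4w; rewrite [K ^ 4](expnM K 2 2) leq_sqr.
  by apply: leq_trans K2; apply: ltnW.
apply: leq_trans K4w; apply: leq_trans dK4.
rewrite mulSn addnC leq_add //; first by lia.
by rewrite leq_mul2l leq_sqr (ltnW jK) orbT.
Qed.

Lemma size_bounds d K w : 0 < K -> w = (2 * K) ^ 3 ->
  let U := K ^ 6 + d * K ^ 5 in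
  [/\ K <= U, d <= U & d * K <= U] /\
  [/\ w <= 8 * U, w * K <= 8 * U, w * K ^ 2 <= 8 * U & w * K ^ 3 <= 8 * U] /\
  d * w * K <= 8 * U /\ d * w * K ^ 2 <= 8 * U.
Proof.
move=> K0 wE U.
have leK a : a <= 6 -> K ^ a <= U.
  by move=> a6; rewrite (leq_trans (leq_pexp2l K0 a6)) // leq_addr.
have ledK a : a <= 5 -> d * K ^ a <= U.
  by move=> a5; rewrite (leq_trans _ (leq_addl _ _)) // leq_mul2l leq_pexp2l ?orbT.
have w8 : w = 8 * K ^ 3 by rewrite wE expnMn.
have w8K a b : 8 * K ^ 3 * K ^ a * b = 8 * (b * K ^ (3 + a)).
  by rewrite expnD; ring.
have dw8 a : d * (8 * K ^ 3) * K ^ a = 8 * (d * K ^ (3 + a)) by rewrite expnD; ring.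
rewrite w8; split; [|split]; split.
- by have := leK 1 isT; rewrite expn1.
- by have := ledK 0 isT; rewrite muln1.
- by have := ledK 1 isT; rewrite expn1.
- by rewrite leq_mul2l leK.
- by have := w8K 1 1; rewrite expn1 muln1 mul1n => ->; rewrite leq_mul2l leK.
- by have := w8K 2 1; rewrite muln1 mul1n => ->; rewrite leq_mul2l leK.
- by have := w8K 3 1; rewrite muln1 mul1n => ->; rewrite leq_mul2l leK.
- by have := dw8 1; rewrite expn1 => ->; rewrite leq_mul2l ledK.
- by rewrite dw8 leq_mul2l ledK.
Qed.

Lemma programSO_computes d X Y K w :
  1 < d -> fundamental_solution d X Y -> X < K -> 64 <= K -> w = (2 * K) ^ 3 ->
  computes (1000 * (K ^ 6 + d * K ^ 5)) (programSO d K w)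
    (fun o => answer o = (X, Y) /\ packed o < 2 ^ (3 * w * K ^ 3)).
Proof.
move=> d1 fund XK K64 wE.
have [A [B [c [[sumE A0 B0] sums]]]] := solution_sums d1 fund XK.
have bounds := entry_bounds fund XK K64 wE.
have excess_lt : \sum_(i < K) i * \sum_(j < K) excess d i j < w.
  by rewrite wE; apply: total_excess_lt; [lia|case: bounds].
have K0 : 0 < K by lia.
have := size_bounds d K0 wE => /=; move: (K ^ 6 + d * K ^ 5) => U.
move=> [[hK hd hdK] [[hw0 hw1 hw2 hw3] [hdw1 hdw2]]].
have w1 : 1 < w by rewrite wE expnS; nia.
have lt_dw : 2 * d < w * 3.
  have [lt_dK _ _ _] := bounds; rewrite wE expnMn [K ^ 3]expnS.
  have : K ^ 2 <= K * K ^ 2 by rewrite leq_pmull.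
  by lia.
clear wE XK.
have fK := fits_self K; have fd := fits_self d.
rewrite /programSO.
apply: (computes_set (m := K)) => [||t tE]; [by fits_trace|size_lia|].
have ft : fits K t by rewrite tE; fits_trace.
apply: (computes_set (m := w)) => [||P PE]; [by fits_trace|size_lia|].
have fP : fits w P by rewrite PE; fits_trace.
apply: (computes_set (m := w)) => [||Pm PmE]; [by fits_trace|size_lia|].
have fPm : fits w Pm by rewrite PmE; fits_trace.
apply: (computes_set (m := w * 3)) => [||q qE]; [by fits_trace|size_lia|].
have fq : fits (w * 3) q by rewrite qE; fits_trace.
apply: (computes_set (m := w * 3 * K)) => [||q1 q1E]; [by fits_trace|size_lia|].
have fq1 : fits (w * 3 * K) q1 by rewrite q1E; fits_trace.
apply: (computes_set (m := w * 3 * K * K)) => [||q2 q2E]; [by fits_trace|size_lia|].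
have fq2 : fits (w * 3 * K * K) q2 by rewrite q2E; fits_trace.
(* the exponent of Q, opaque so that the size comparisons below stay linear *)
pose mQ := w * 3 * K + w * 3 * K * K.
have hmQ : mQ <= 48 * U by rewrite /mQ; size_lia.
have hmQK : mQ * K <= 48 * U by rewrite /mQ; size_lia.
apply: (computes_set (m := mQ)) => [||Q QE]; [by fits_trace|size_lia|].
have fQ : fits mQ Q by rewrite QE; fits_trace.
clearbody mQ.
rewrite /= in PE PmE qE q1E q2E QE.
have P4 : 4 <= P by rewrite PE -[4]/(2 ^ 2) leq_exp2l.
have q4 : 4 < q.
  by rewrite (leq_ltn_trans P4) // qE -{1}(expn1 P) ltn_exp2l // (leq_trans _ P4).
have q1_ge : q <= q1 by rewrite q1E -{1}(expn1 q) leq_pexp2l // (leq_trans _ q4).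
have q1_gt0 : 0 < q1 by apply: leq_trans q1_ge; apply: leq_trans q4.
have q2_gt0 : 0 < q2 by rewrite q2E expn_gt0 q1_gt0.
have Q4 : 4 < Q by rewrite QE (leq_trans q4) // (leq_trans q1_ge) // leq_pmulr.
have K1 : 1 < K by apply: leq_trans K64.
apply: (computes_bind (subG02_computes (ZQ0 := None) (n := 1000 * U) Q4 K1 tE fQ isT _)).
  by size_lia.
move=> [U0 U2] [/= [U0E U2E] fU0 fU2].
apply: (computes_bind (subG02_computes (ZQ0 := Some q1) (n := 1000 * U) q4 K1 tE fq q1E _)).
  by size_lia.
move=> [V0 V2] [/= [V0E V2E] fV0 fV2].
apply: (computes_set (m := 400 * U)) => [||Ts TsE]; [by fits_trace|size_lia|].
have fTs : fits (400 * U) Ts by rewrite TsE; fits_trace.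
apply: (computes_set (m := 400 * U)) => [||M ME]; [by fits_trace|size_lia|].
pose row := entry_row d w K.
have row_lt i : i < K -> (row i).+1 < q1.
  move=> iK; rewrite q1E qE PE.
  apply: (sum_digits_pred_lt (a := entry d w i)) => [|j jK]; first exact: ltnW.
  by apply: entry_small => //; case: bounds => _ _ smallY _; apply: smallY.
have {}ME : M = stacked q1 K row.
  rewrite ME /= TsE /= PmE PE U0E U2E V0E V2E.
  rewrite packed_sum; [|by case: bounds|by rewrite qE PE].
  by rewrite QE q2E; apply: stacked_quotient.
have weightM : weight M = (K * \sum_(i < K) i + A) * w
    + \sum_(i < K) i * \sum_(j < K) excess d i j.
  by rewrite ME q1E qE PE weight_packed ?sumE //; case: bounds.
have M0 : 0 < M.
  rewrite lt0n; apply/eqP => M_eq0; move: weightM; rewrite M_eq0 weight0.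
  move=> /esym/eqP; rewrite addn_eq0 muln_eq0 addn_eq0.
  by rewrite (gtn_eqF A0) (gtn_eqF (ltnW w1)) andbF.
have M_lt : M < 2 ^ (3 * w * K ^ 3).
  rewrite ME; apply: leq_trans (stacked_lt (fun i iK => ltnW (row_lt i iK))) _.
  by rewrite q1E qE PE -!expnM leq_exp2l //; size_lia.
have HE := subH_weight M0.
apply: (computes_bind (Q := fun h => h = subH M)).
  split=> //=; rewrite andbT HE; apply: fits_trans (leq_weight M).
  by apply: fits_leq (ltnW M_lt) _; size_lia.
move=> HM HME; have fHM : fits (24 * U) HM.
  rewrite HME HE; apply: fits_trans (leq_weight M).
  by apply: fits_leq (ltnW M_lt) _; size_lia.
apply: (computes_set (m := 3 * K)) => [||sigma sE]; [by fits_trace|size_lia|].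
apply: (computes_set (m := 24 * U)) => [||A' A'E]; [by fits_trace|size_lia|].
have fA' : fits (24 * U) A' by rewrite A'E; fits_trace.
have {}A'E : A' = A.
  rewrite A'E /= HME HE weightM sE /= tE /= sigma_eq divnMDl; last exact: ltnW.
  by rewrite (divn_small excess_lt) addn0 addKn.
rewrite {}A'E in fA' *.
have [eqA eqc hi] := sums.
have [/pell_solution_nat[X0 Y0 normE] _] := fund.
have lo : d * B ^ 2 <= A ^ 2 by rewrite eqA addnAC leq_addl.
have q1P : q1 = 2 ^ (w * 3 * K) by rewrite q1E qE PE -!expnM mulnA.
have lt_q1 : 2 * (d * K) < w * 3 * K.
  by rewrite mulnA ltn_mul2r K0.
rewrite q2E.
apply: (computes_bind (subC_computes (n := 1000 * U) d1 K0 q1P lt_q1 fA' lo hi _)).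
  by clear lo hi eqA eqc normE; size_lia.
move=> _ [-> fB'].
have fB : fits (100 * U) B by apply: fits_leq fB' _; clear lo hi eqA eqc normE; size_lia.
apply: (computes_bind (subR_computes (n := 1000 * U) (ltnW d1) normE Y0 B0 eqA eqc
  (fits_leq fA' (_ : 24 * U <= 100 * U)) fB _)).
- by rewrite leq_mul2r orbT.
- by clear lo hi eqA eqc normE; size_lia.
by move=> _ ->.
Qed.

Lemma bits_ltn n v : 0 < n -> v < 2 ^ n -> bits v <= n.
Proof.
move=> n0 lt_v; rewrite /bits; case: (posnP v) => [->|v0]; first by rewrite trunc_log0.
by rewrite -(@ltn_exp2l 2) // (leq_ltn_trans _ lt_v) // trunc_logP.
Qed.

Lemma bits_fits n v : fits n v -> bits v <= n.+1.
Proof. by move=> hv; rewrite bits_ltn // (leq_ltn_trans hv) // ltn_exp2l. Qed.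

Theorem theorem11 :
  exists C1 C2 C3 : nat,
  forall d X1 Y1 K w : nat,
    2 <= d ->
    (forall s : nat, d <> s ^ 2) ->
    fundamental_solution d X1 Y1 ->
    X1 < K ->
    64 <= K ->
    w = (2 * K) ^ 3 ->
    [/\ answer (result (programSO d K w)) = (X1, Y1),
        bits (packed (result (programSO d K w))) <= 3 * w * K ^ 3
          /\ 3 * w * K ^ 3 <= C1 * K ^ 6,
        forall v : nat, v \in intermediates (programSO d K w) ->
          bits v <= C2 * (K ^ 6 + d * K ^ 5)
      & d <= K ->
        forall v : nat, v \in intermediates (programSO d K w) ->
          bits v <= C3 * K ^ 6].
Proof.
exists 24, 1001, 2002 => d X1 Y1 K w d2 _ fund XK K64 wE.
have [/allP sizes [-> packed_lt]] := programSO_computes d2 fund XK K64 wE.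
have K0 : 0 < K by apply: leq_trans K64.
have w0 : 0 < w by rewrite wE expn_gt0 muln_gt0 K0.
have le_bits v : v \in intermediates (programSO d K w) ->
    bits v <= 1001 * (K ^ 6 + d * K ^ 5).
  move=> /sizes/bits_fits/leq_trans; apply.
  have : 0 < K ^ 6 + d * K ^ 5 by rewrite addn_gt0 expn_gt0 K0.
  by move: (K ^ 6 + _) => U; lia.
split=> //.
  split; first by apply: bits_ltn => //; rewrite !muln_gt0 w0 !K0.
  by rewrite wE expnMn mulnA -mulnA -expnD.
move=> le_dK v /le_bits/leq_trans; apply.
have -> : 2002 * K ^ 6 = 1001 * (K ^ 6 + K * K ^ 5) by rewrite -expnS addnn -mul2n mulnA.
by rewrite leq_mul2l leq_add2l leq_mul2r le_dK orbT.
Qed.
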